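(* Up to Euclidean motions, there is only one concave extangential LEQ that is not a kite; it is the LEQ with vertices $(0,0),(12,5),(10,5),(6,8)$ and side lengths $(13,2,5,10)$.
   Context: A quadrilateral is given by four cyclically ordered points of the plane, no three colinear, such that the four sides have no interior points of intersection. A lattice equable quadrilateral (LEQ) is a quadrilateral whose vertices lie on $\mathbb Z^2$ and whose area equals its perimeter. A kite is a quadrilateral having one of its diagonals as an axis of symmetry. A quadrilateral with consecutive side lengths $a,b,c,d$ is extangential if it has an excircle, i.e. a circle exterior to it that is tangent to the extensions of all four sides; equivalently, it has no pair of parallel sides and $|a-c|=|b-d|$. Euclidean motions are elements of the group generated by translations, rotations and reflections of the plane. *)

(* Defs.v *)
From mathcomp Require Import all_boot all_order all_algebra.
From mathcomp Require Import boolp classical_sets reals convex.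
Set Implicit Arguments.
Unset Strict Implicit.
Unset Printing Implicit Defensive.
Import Order.TTheory GRing.Theory Num.Theory.
Local Open Scope classical_set_scope.
Local Open Scope ring_scope.

(* [R^o] rather than [R], so that the plane is an [lmodType R]. *)
Definition plane (R : realType) : lmodType R := (R^o * R^o)%type.

Section Plane.
Variable R : realType.
Implicit Types (a b c p v : plane R) (r t : R).

Definition dot a b : R := a.1 * b.1 + a.2 * b.2.

Definition cross a b : R := a.1 * b.2 - a.2 * b.1.

(* The norm of the product space is the sup norm, hence this definition. *)
Definition dist a b : R := Num.sqrt (dot (b - a) (b - a)).

(* Twice the signed area of the triangle [a b c]. *)
Definition det3 a b c : R := cross (b - a) (c - a).

Definition collinear a b c : Prop := det3 a b c = 0.

Definition line a b : set (plane R) := [set a + t *: (b - a) | t in [set: R]].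

Definition open_segment a b : set (plane R) :=
  [set a + t *: (b - a) | t in [set t | 0 < t < 1]].

Definition triangle a b c : set (plane R) :=
  [set p | exists s t u : R, [/\ 0 <= s, 0 <= t, 0 <= u, s + t + u = 1 &
    p = s *: a + t *: b + u *: c]].

Definition circle c r : set (plane R) := [set p | dist c p = r].

Definition open_disc c r : set (plane R) := [set p | dist c p < r].

Definition translation v p : plane R := p + v.

(* Rotation about [c] by the angle with cosine [x] and sine [y]
   (for [x ^+ 2 + y ^+ 2 = 1]). *)
Definition rotation c (x y : R) p : plane R :=
  let w := p - c in c + (x * w.1 - y * w.2, y * w.1 + x * w.2).

(* Reflection in the line through [a] and [b] (for [a <> b]): the component of
   [p - a] along [b - a] is kept and the orthogonal one is negated. *)
Definition reflection a b p : plane R :=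
  let d := b - a in a + (2 * (dot (p - a) d / dot d d)) *: d - (p - a).

Inductive euclidean_motion : (plane R -> plane R) -> Prop :=
| motion_translation v : euclidean_motion (translation v)
| motion_rotation c (x y : R) :
    x ^+ 2 + y ^+ 2 = 1 -> euclidean_motion (rotation c x y)
| motion_reflection a b : a != b -> euclidean_motion (reflection a b)
| motion_comp f g :
    euclidean_motion f -> euclidean_motion g -> euclidean_motion (f \o g)
| motion_inv f g :
    euclidean_motion f -> cancel f g -> cancel g f -> euclidean_motion g.

(* The indices live in 'I_4 with its addition modulo 4, so [q i], [q (i + 1)]
   are consecutive vertices and [q i], [q (i + 2)] opposite ones. *)
Definition points4 : Type := 'I_4 -> plane R.
Implicit Types q : points4.

Definition quadrilateral q : Prop :=
  (forall i j k : 'I_4, i != j -> j != k -> i != k ->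
     ~ collinear (q i) (q j) (q k)) /\
  (forall i j : 'I_4, i != j ->
     open_segment (q i) (q (i + 1)) `&` open_segment (q j) (q (j + 1)) = set0).

(* Two labellings of the same cyclically ordered vertices; the direction in
   which the boundary is traversed is immaterial. *)
Definition same_quad q q' : Prop :=
  exists k : 'I_4, (forall i, q' i = q (k + i)) \/ (forall i, q' i = q (k - i)).

Definition side q (i : 'I_4) : R := dist (q i) (q (i + 1)).

Definition perimeter q : R := \sum_i side q i.

(* Shoelace formula. *)
Definition area q : R := `|\sum_i cross (q i) (q (i + 1))| / 2.

(* For a quadrilateral in the above sense, the diagonal from [q i] to
   [q (i + 2)] lies inside iff its line separates the two other vertices. *)
Definition inner_diagonal q (i : 'I_4) : Prop :=
  det3 (q i) (q (i + 2)) (q (i + 1)) * det3 (q i) (q (i + 2)) (q (i + 3)) < 0.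

(* The closed region bounded by the quadrilateral: an inner diagonal cuts it
   into two triangles. *)
Definition region q : set (plane R) :=
  [set p | exists2 i : 'I_4, inner_diagonal q i &
    triangle (q i) (q (i + 1)) (q (i + 2)) p \/
    triangle (q i) (q (i + 3)) (q (i + 2)) p].

Definition concave q : Prop := ~ convex_set (region q).

Definition kite q : Prop :=
  exists i : 'I_4, same_quad q (reflection (q i) (q (i + 2)) \o q).

Definition tangent c r a b : Prop :=
  exists! p, (line a b `&` circle c r) p.

(* The sides are extended to full lines: for a concave quadrilateral the
   excircle touches the two sides at the reflex vertex themselves. *)
Definition extangential q : Prop :=
  exists c r, [/\ 0 < r,
    forall i : 'I_4, tangent c r (q i) (q (i + 1)) &
    open_disc c r `&` region q = set0].

Definition LEQ q : Prop :=
  [/\ quadrilateral q,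
      forall i, (q i).1 \is a Num.int /\ (q i).2 \is a Num.int &
      area q = perimeter q].

Definition quad (a b c d : plane R) : points4 :=
  fun i => nth 0 [:: a; b; c; d] i.

End Plane.

(* Main.v *)
(* Let [C] be the reflex vertex of the quadrilateral [ABCD].  The excircle lies
   beyond [C] inside the angle at [A], and equality of tangent lengths gives
   [AB + BC = CD + DA = s].  As the area is half an integer and the squared sides
   are integers, the sides [a, b, c, d] are integers.  Heron's formula for the two
   triangles cut off by [AC], together with area [2 s], shows that
   [t = 16 s^2 / (s^2 - AC^2)] satisfies
   [(t + w^2) (t + z^2) = s^2 (t - 16)] with [w = a - c], [z = c - b].  Hence [t] is
   an integer; the lattice condition gives [t | w^2 z^2] and [t | 16 z^2 (z + 2 b)^2],
   and concavity gives [w z < t < w (z + 2 b)].  These conditions bound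
   [b], [w], [z], and a finite search leaves only [(b, w, z) = (2, 8, 3)] (if
   [z = 0] the quadrilateral is a kite, and [z < 0] is excluded by relabelling). *)

(* The position of the excircle rests on one fact: a circle tangent to two non-parallel lines
   touches each strictly on the centre's side of the other. No two side lines are parallel, so this
   gives twelve sign conditions. They leave two positions: the centre inside the quadrilateral, or
   beyond [C] with the feet on [AB] and [AD] extended. The former is impossible, as the centre lies
   in the open disc. The search is finite for several reasons. The equation alone gives
   [b w z (b + w + z) < 4 s^2]. If [w z < 32], this together with [t >= 17] bounds [b]. Otherwise
   [b min(w, z) < 16], and the inequality bounds the larger of [w] and [z] once [b min(w, z) >= 5].
   Below 5 it does not, and only the divisibility conditions supply a bound. *)
From Stdlib Require Import ZArith Lia Znumtheory Bool.

(** * The Diophantine system and its finite search *)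

Section Diophantine.
Local Open Scope Z_scope.

(* For fixed [b], [w], [z] the equation of [reduced_system] is quadratic in [t];
   the bounds on [t] select the smaller root, so its discriminant [disc] must be
   a square. *)
Definition sieve (b w z : Z) : bool :=
  let S := b + w + z in
  let disc := 4 * b * b * S * S - 16 * (S + b) * (S + b) + 4 * b * w * z * S in
  let r := Z.sqrt disc in
  let t := w * z + 2 * b * S - r in
  if (disc <? 0) then true else
  if negb (r * r =? disc) then true else
  if (2 * b * S - r <=? 0) || (2 * b * w <=? 2 * b * S - r) then true else
  if (w * w * z * z) mod t =? 0 then (b =? 2) && (w =? 8) && (z =? 3) else true.

Fixpoint upto (f : Z -> bool) (n : nat) : bool :=
  match n with O => true | S n => f (Z.of_nat (S n)) && upto f n end.

Lemma uptoP f n x : upto f n = true -> 0 < x <= Z.of_nat n -> f x = true.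
Proof.
induction n as [|n IH]; [lia|]. cbn [upto]. intros H Hx.
apply andb_prop in H. destruct H as [H1 H2].
destruct (Z.eq_dec x (Z.of_nat (S n))) as [->|]; [exact H1|]. apply IH; [exact H2|lia].
Qed.

(* With [a + b = c + d = s], [w = a - c], [z = c - b] and [n] the square of the
   diagonal through the reflex vertex, [t = 16 s^2 / (s^2 - n)].  The equation
   is [t^2 - (s^2 - w^2 - z^2) t + w^2 z^2 + 16 s^2 = 0], with [s = 2 b + w + z]. *)
Definition reduced_system b w z t :=
  0 < b /\ 0 < w /\ 0 < z /\ w * z < t /\ t < w * (z + 2 * b) /\ 17 <= t /\
  (t - w * z) * (4 * b * (b + w + z) - (t - w * z)) + 4 * b * w * z * (b + w + z)
    = 16 * (2 * b + w + z) * (2 * b + w + z) /\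
  (t | w * w * z * z) /\ (t | 16 * z * z * (z + 2 * b) * (z + 2 * b)).

Lemma sieveP b w z t : reduced_system b w z t -> sieve b w z = true -> b = 2 /\ w = 8 /\ z = 3 /\ t = 36.
Proof.
intros (hb & hw & hz & h1 & h2 & h17 & E & d1 & _).
unfold sieve. set (S := b + w + z) in *.
set (disc := 4 * b * b * S * S - _ + _).
assert (Er : disc = (2 * b * S - (t - w * z)) * (2 * b * S - (t - w * z))).
  unfold disc. replace (2 * b + w + z) with (S + b) in E by (unfold S; ring). lia.
assert (P : 0 <= 2 * b * S - (t - w * z)).
  assert (0 < b * (b + z)) by (apply Z.mul_pos_pos; lia). unfold S; lia.
rewrite Er, Z.sqrt_square by exact P.
set (r := 2 * b * S - (t - w * z)) in *.
destruct (Z.ltb_spec (r * r) 0); [pose proof (Z.square_nonneg r); lia|].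
rewrite Z.eqb_refl. cbn [negb].
replace (2 * b * S - r) with (t - w * z) by (unfold r; ring).
destruct (Z.leb_spec (t - w * z) 0); [lia|].
destruct (Z.leb_spec (2 * b * w) (t - w * z)); [lia|]. cbn [orb].
replace (w * z + 2 * b * S - r) with t by (unfold r; ring).
rewrite (Zdivide_mod _ _ d1), Z.eqb_refl.
intros H'. apply andb_prop in H'. destruct H' as [H' Hz]. apply andb_prop in H'.
destruct H' as [Hb Hw]. apply Z.eqb_eq in Hz, Hb, Hw. subst b w z.
(* For [(b, w, z) = (2, 8, 3)] the roots are 36 and 116, while [t < w (z + 2 b) = 56]. *)
unfold S in *. repeat split. clear - E h1 h2. assert (F : (t - 36) * (t - 116) = 0) by lia.
apply Z.mul_eq_0 in F. lia.
Qed.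

Lemma bound_prod b w z t : reduced_system b w z t ->
  b * (w * z) * (b + w + z) < 4 * (2 * b + w + z) * (2 * b + w + z).
Proof.
intros (hb & hw & hz & h1 & h2 & h17 & E & _).
assert (0 < (t - w * z) * (4 * b * (b + w + z) - (t - w * z))).
  assert (0 < b * (b + z)) by (apply Z.mul_pos_pos; lia).
  assert (0 < b * w) by (apply Z.mul_pos_pos; lia).
  apply Z.mul_pos_pos; lia.
lia.
Qed.

(** With [S = b + w + z], the right side of [bound_prod] is [4 (S + b)^2 <= (4 S + 12 b) S] because
    [b <= S]; a factor [S] cancels. *)
Lemma bound_lin b w z t : reduced_system b w z t -> b * (w * z) < 16 * b + 4 * w + 4 * z.
Proof.
intros H. pose proof (bound_prod _ _ _ _ H) as X.
destruct H as (hb & hw & hz & _).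
set (S := b + w + z) in *. replace (2 * b + w + z) with (S + b) in X by (unfold S; ring).
assert (b * b <= b * S) by (apply Z.mul_le_mono_nonneg_l; unfold S; lia).
assert ((b * (w * z)) * S < (4 * S + 12 * b) * S) by lia.
assert (b * (w * z) < 4 * S + 12 * b) by (apply Z.mul_lt_mono_pos_r with S; unfold S in *; lia).
unfold S in *; lia.
Qed.

(** For [w z >= 32] the term [16 b] is at most half of [b w z], and [4 w + 4 z <= 8 w]. The
    hypothesis is an inequality symmetric in [w] and [z], unlike [reduced_system], so the lemma also
    applies with the two exchanged; the same holds for [bound_max]. *)
Lemma bound_min b w z : 0 < b -> 0 < w -> 0 < z ->
  b * (w * z) < 16 * b + 4 * w + 4 * z -> z <= w -> 32 <= w * z -> b * z < 16.
Proof.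
intros hb hw hz X zw h.
assert (b * 32 <= b * (w * z)) by (apply Z.mul_le_mono_nonneg_l; lia).
assert ((b * z) * w < 16 * w) by lia.
apply Z.mul_lt_mono_pos_r with w; lia.
Qed.

Lemma bound_small b w z t : reduced_system b w z t -> w * z < 32 -> b < 132.
Proof.
intros H h. pose proof (bound_lin _ _ _ _ H) as X.
destruct H as (hb & hw & hz & h1 & h2 & h17 & E & _).
assert (0 <= (w - 1) * (z - 1)) by (apply Z.mul_nonneg_nonneg; lia).
destruct (Z_lt_le_dec 16 (w * z)) as [g|g].
  assert (b * 17 <= b * (w * z)) by (apply Z.mul_le_mono_nonneg_l; lia). lia.
assert (w + z <= 17) by lia.
set (S := b + w + z) in *. replace (2 * b + w + z) with (S + b) in E by (unfold S; ring).
assert (0 < b * (b + z)) by (apply Z.mul_pos_pos; lia).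
assert (0 < b * w) by (apply Z.mul_pos_pos; lia).
assert (b * S = b * (b + z) + b * w) by (unfold S; ring).
(* The product [u (4 b S - u)] with [u = t - w z] grows with [u] in this range, so [t] may be
   replaced by 17. This gives [68 b S] on the left against [16 (S + b)^2], which is about [64 b^2]
   for large [b]: the margin 68 > 64 bounds [b]. *)
assert (0 <= (t - 17) * (4 * b * S - (t - w * z) - (17 - w * z))).
  apply Z.mul_nonneg_nonneg; [lia|].
  assert (b * 1 <= b * w) by (apply Z.mul_le_mono_nonneg_l; lia).
  assert (b * 1 <= b * z) by (apply Z.mul_le_mono_nonneg_l; lia).
  destruct (Z_lt_le_dec 3 b) as [k|k]; [|lia].
  assert (4 * b <= b * b) by (apply Z.mul_le_mono_nonneg_r; lia). lia.
assert (68 * (b * S) <= 16 * (S + b) * (S + b) + (17 - w * z) * (17 - w * z)) by lia.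
assert ((17 - w * z) * (17 - w * z) <= 16 * 16) by (apply Z.mul_le_mono_nonneg; lia).
destruct (Z_lt_le_dec b 132) as [k|k]; [exact k|exfalso].
assert (b * b + b * (w + z) <= 4 * ((w + z) * (w + z)) + 64) by (unfold S in *; lia).
assert ((w + z) * (w + z) <= 17 * 17) by (apply Z.mul_le_mono_nonneg; lia).
assert (132 * b <= b * b) by (apply Z.mul_le_mono_nonneg_r; lia).
assert (0 < b * (w + z)) by (apply Z.mul_pos_pos; lia).
lia.
Qed.

(** As polynomials in [w], the two sides of the inequality have leading terms [b z w^2] and [4 w^2],
    so [b z >= 5] bounds [w]. *)
Lemma bound_max b w z : 0 < b -> 0 < w -> 0 < z ->
  b * (w * z) * (b + w + z) < 4 * (2 * b + w + z) * (2 * b + w + z) ->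
  5 <= b * z -> w < 14 * b + 5 * z.
Proof.
intros hb hw hz X h5.
destruct (Z_lt_le_dec w (14 * b + 5 * z)) as [k|k]; [exact k|exfalso].
set (S := b + w + z) in *. replace (2 * b + w + z) with (S + b) in X by (unfold S; ring).
assert (5 * (w * S) <= (b * z) * (w * S)).
  apply Z.mul_le_mono_nonneg_r; [apply Z.mul_nonneg_nonneg; unfold S; lia|lia].
replace (5 * (w * S)) with (5 * S * S - 5 * b * S - 5 * z * S) in * by (unfold S; ring).
assert ((14 * b + 5 * z) * S <= S * S) by (apply Z.mul_le_mono_nonneg_r; unfold S; lia).
assert (b * (4 * b) <= b * S) by (apply Z.mul_le_mono_nonneg_l; unfold S; lia).
assert (0 < b * b) by (apply Z.mul_pos_pos; lia).
lia.
Qed.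

(** Serves the case [b z < 5]: here [w z < t], and [t] is at most the positive number it divides. *)
Lemma bound_w b w z t : reduced_system b w z t -> w < 16 * z * (z + 2 * b) * (z + 2 * b).
Proof.
intros (hb & hw & hz & h1 & _ & _ & _ & _ & d2).
apply Z.divide_pos_le in d2.
- apply Z.mul_lt_mono_pos_r with z; [lia|]. lia.
- repeat apply Z.mul_pos_pos; lia.
Qed.

(** Counterpart of [bound_w] for [b w < 5]. From [t | w^2 z^2] follows [t | (t - w z)^2], and this
    square is at most [(2 b w)^2], a bound free of [z]. *)
Lemma bound_z b w z t : reduced_system b w z t -> z < 4 * b * b * w.
Proof.
intros (hb & hw & hz & h1 & h2 & _ & _ & d1 & _).
assert (d : (t | (t - w * z) * (t - w * z))).
  replace ((t - w * z) * (t - w * z)) with (t * (t - 2 * w * z) + w * w * z * z) by ring.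
  apply Z.divide_add_r; [apply Z.divide_factor_l|exact d1].
apply Z.divide_pos_le in d; [|apply Z.mul_pos_pos; lia].
assert ((t - w * z) * (t - w * z) <= (2 * b * w) * (2 * b * w)) by (apply Z.mul_le_mono_nonneg; lia).
apply Z.mul_lt_mono_pos_r with w; lia.
Qed.

(* The bound [k] is only needed for [x * y < 5]; for [16 <= x * y] there is
   nothing to search. *)
Definition cap (k x y : Z) : nat :=
  Z.to_nat (if x * y <? 5 then k else if x * y <? 16 then 14 * x + 5 * y else 0).

(** The product [w z < 32] keeps each factor at most 31; 131 comes from [bound_small]. *)
Lemma search_small : upto (fun w => upto (fun z =>
  if w * z <? 32 then upto (fun b => sieve b w z) 131 else true) 31) 31 = true.
Proof. vm_compute. reflexivity. Qed.

Lemma search_w : upto (fun b => upto (fun z =>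
  upto (fun w => sieve b w z) (cap (16 * z * (z + 2 * b) * (z + 2 * b)) b z)) 15) 15 = true.
Proof. vm_compute. reflexivity. Qed.

Lemma search_z : upto (fun b => upto (fun w =>
  upto (fun z => sieve b w z) (cap (4 * b * b * w) b w)) 15) 15 = true.
Proof. vm_compute. reflexivity. Qed.

Lemma reduced_system_solution b w z t : reduced_system b w z t -> b = 2 /\ w = 8 /\ z = 3 /\ t = 36.
Proof.
intros H. apply sieveP with (1 := H).
pose proof search_small as T1. pose proof search_w as T2. pose proof search_z as T3.
pose proof (bound_w _ _ _ _ H) as Bw. pose proof (bound_z _ _ _ _ H) as Bz.
pose proof (bound_lin _ _ _ _ H) as L. pose proof (bound_prod _ _ _ _ H) as P.
pose proof (bound_small _ _ _ _ H) as Sm.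
destruct H as (hb & hw & hz & _).
destruct (Z_lt_le_dec (w * z) 32) as [h|h].
- specialize (Sm h).
  assert (0 <= (w - 1) * (z - 1)) by (apply Z.mul_nonneg_nonneg; lia).
  apply uptoP with (x := w) in T1; [|lia]. apply uptoP with (x := z) in T1; [|lia].
  apply Z.ltb_lt in h. rewrite h in T1. apply uptoP with (x := b) in T1; [exact T1|lia].
- destruct (Z_le_gt_dec z w) as [g|g].
  + pose proof (bound_min b w z hb hw hz L g h) as m.
    assert (0 <= (b - 1) * (z - 1)) by (apply Z.mul_nonneg_nonneg; lia).
    apply uptoP with (x := b) in T2; [|lia]. apply uptoP with (x := z) in T2; [|lia].
    apply uptoP with (x := w) in T2; [exact T2|]. unfold cap.
    destruct (Z.ltb_spec (b * z) 5) as [k|k]; [lia|].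
    pose proof (bound_max b w z hb hw hz P k). destruct (Z.ltb_spec (b * z) 16); lia.
  + replace (w * z) with (z * w) in * by ring.
    assert (m : b * w < 16) by (apply (bound_min b z w); lia).
    assert (0 <= (b - 1) * (w - 1)) by (apply Z.mul_nonneg_nonneg; lia).
    apply uptoP with (x := b) in T3; [|lia]. apply uptoP with (x := w) in T3; [|lia].
    apply uptoP with (x := z) in T3; [exact T3|]. unfold cap.
    destruct (Z.ltb_spec (b * w) 5) as [k|k]; [lia|].
    assert (z < 14 * b + 5 * w) by (apply bound_max; lia). destruct (Z.ltb_spec (b * w) 16); lia.
Qed.

(** * Integrality of [t] and reduction to the search *)

Lemma divide_of_square x y : 0 < y -> (y * y | x * x) -> (y | x).
Proof.
intros hy [k hk].
assert (g0 : Z.gcd x y <> 0) by (intros e; apply Z.gcd_eq_0_r in e; lia).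
destruct (Z.gcd_divide_l x y) as [x' hx]. destruct (Z.gcd_divide_r x y) as [y' hy'].
pose proof (Z.gcd_div_gcd x y _ g0 eq_refl) as co.
set (g := Z.gcd x y) in *.
assert (ex : x / g = x') by (rewrite hx; apply Z.div_mul; exact g0).
assert (ey : y / g = y') by (rewrite hy'; apply Z.div_mul; exact g0).
rewrite ex, ey in co. apply Zgcd_1_rel_prime in co.
assert (rp : rel_prime y' (x' * x')).
  apply rel_prime_mult; apply rel_prime_sym; exact co.
assert (d : (y' | x' * x')).
  exists (k * y'). apply Z.mul_reg_l with (g * g); [nia|].
  rewrite hx, hy' in hk. lia.
apply Zgcd_1_rel_prime in rp.
assert (d1 : (y' | 1)) by (rewrite <- rp; apply Z.gcd_greatest; [apply Z.divide_refl|exact d]).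
destruct d1 as [j hj]. exists (x' * j).
rewrite hy', hx at 1. replace (x' * j * (y' * g)) with (x' * (j * y') * g) by ring.
rewrite <- hj. ring.
Qed.

(** [N / m] is a root of [x^2 - P x + Q]. Completing the square gives
    [(2 N - P m)^2 = m^2 (P^2 - 4 Q)], so [2 N / m] is an integer; the equation modulo 2 shows that
    it is even. *)
Lemma monic_root_integral m N P Q : 0 < m ->
  N * N - P * N * m + Q * m * m = 0 -> (m | N).
Proof.
intros hm E.
assert (d : (m | 2 * N - P * m)).
  apply divide_of_square; [exact hm|]. exists (P * P - 4 * Q). lia.
destruct d as [k k_eq].
assert (k2 : (k + P) * m = 2 * N) by lia.
assert (e : m * m * ((k + P) * (k + P) - 2 * P * (k + P) + 4 * Q) = 0).
  replace (m * m * ((k + P) * (k + P) - 2 * P * (k + P) + 4 * Q)) with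
    (((k + P) * m) * ((k + P) * m) - 2 * P * m * ((k + P) * m) + 4 * Q * m * m) by ring.
  rewrite k2. lia.
apply Z.mul_eq_0 in e. destruct e as [e|e]; [nia|].
destruct (Z.Even_or_Odd (k + P)) as [[j hj]|[j hj]]; [exists j; lia|exfalso].
rewrite hj in e. lia.
Qed.

(** Here [n = AC^2], and [D1], [D2] are the doubled areas of [ABC] and [ACD]. The quadratic
    hypotheses are Heron's formula, [D1 + D2 = 4 (a + b)] is equability, and the last hypothesis
    encodes that [C] is a reflex vertex. *)
Lemma excircle_diophantine a b c d n D1 D2 :
  0 < a -> 0 < b -> 0 < c -> 0 < d -> 0 < D1 -> 0 < D2 -> 0 < n -> b < c ->
  a + b = c + d -> D1 + D2 = 4 * (a + b) ->
  4 * (D1 * D1) = ((a + b) * (a + b) - n) * (n - (a - b) * (a - b)) ->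
  4 * (D2 * D2) = ((a + b) * (a + b) - n) * (n - (d - c) * (d - c)) ->
  0 < D2 * ((a - b) * (a + b) - n) + D1 * ((d - c) * (a + b) - n) ->
  a = 13 /\ b = 2 /\ c = 5 /\ d = 10 /\ n = 125 /\ D1 = 10 /\ D2 = 50.
Proof.
intros ha hb hc hd h1 h2 hn bc ed eK E1 E2 V.
set (w := a - c). set (z := c - b).
assert (hz : 0 < z) by (unfold z; lia).
set (s := w + z + 2 * b). assert (hs : a + b = s) by (unfold s, w, z; lia).
assert (s0 : 0 < s) by lia.
rewrite hs in *.
replace (a - b) with (w + z) in * by (unfold w, z; lia).
replace (d - c) with (w - z) in * by (unfold w, z; lia).
set (m := s * s - n) in *. set (dl := D2 - D1).
(* The two factors of [4 D1^2] have a positive product and the positive sum [4 a b], so both are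
   positive. *)
assert (m0 : 0 < m).
  assert (0 < m * (n - (w + z) * (w + z))) by (rewrite <- E1; nia).
  assert (0 < m + (n - (w + z) * (w + z))).
    assert (0 < a * b) by (apply Z.mul_pos_pos; lia). unfold m, s, w, z; lia.
  destruct (Z_lt_le_dec 0 m) as [k|k]; [exact k|exfalso].
  assert (0 <= - m * (n - (w + z) * (w + z))) by (apply Z.mul_nonneg_nonneg; lia). lia.
(* [F1] and [F2] are the difference and the sum of the two Heron equations, with [D1 + D2] replaced
   by [4 s]. *)
assert (F1 : 4 * s * dl = m * w * z).
  assert (4 * (dl * (D1 + D2)) = 4 * m * w * z) by (unfold dl; lia).
  rewrite eK in H. lia.
assert (F2 : 16 * s * s + dl * dl = m * (n - w * w - z * z)).
  assert (2 * ((D1 + D2) * (D1 + D2) + dl * dl) = 2 * m * (n - w * w - z * z)) by (unfold dl; lia).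
  rewrite eK in H. lia.
set (P := s * s - w * w - z * z). set (Q := w * w * z * z + 16 * s * s).
assert (nE : n = s * s - m) by (unfold m; lia).
(* [16 s^2 / m] is a root of a monic integer polynomial, hence an integer. *)
assert (R0 : (16 * s * s) * (16 * s * s) - P * (16 * s * s) * m + Q * m * m = 0).
  replace (Q * m * m) with ((m * w * z) * (m * w * z) + 16 * s * s * m * m) by (unfold Q; ring).
  rewrite <- F1.
  replace ((16 * s * s) * (16 * s * s) - P * (16 * s * s) * m +
    ((4 * s * dl) * (4 * s * dl) + 16 * s * s * m * m)) with
    ((16 * s * s) * ((16 * s * s + dl * dl) - m * (s * s - m - w * w - z * z))) by (unfold P; ring).
  rewrite F2, nE. ring.
destruct (monic_root_integral m _ _ _ m0 R0) as [t ht].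
assert (t0 : 0 < t) by nia.
assert (Et : t * t - P * t + Q = 0).
  rewrite ht in R0. apply Z.mul_reg_l with (m * m); [nia|]. lia.
assert (G1 : t * dl = 4 * s * w * z).
  apply Z.mul_reg_l with (4 * s); [lia|].
  replace (4 * s * (t * dl)) with (t * (4 * s * dl)) by ring. rewrite F1.
  replace (t * (m * w * z)) with ((t * m) * w * z) by ring. rewrite <- ht. ring.
assert (G2 : t * D1 = 2 * s * (t - w * z)).
  assert (2 * (t * D1) = t * (D1 + D2) - t * dl) by (unfold dl; ring). rewrite eK in H. lia.
assert (G3 : t * D2 = 2 * s * (t + w * z)).
  assert (2 * (t * D2) = t * (D1 + D2) + t * dl) by (unfold dl; ring). rewrite eK in H. lia.
assert (Q1 : w * z < t).
  assert (0 < t * D1) by (apply Z.mul_pos_pos; lia). rewrite G2 in H. apply Z.lt_0_mul in H. lia.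
assert (tn : t * n = (t + w * w) * (t + z * z)).
  rewrite nE. replace (t * (s * s - m)) with (t * s * s - t * m) by ring. rewrite <- ht.
  unfold P, Q in Et. lia.
(* Multiplied by [t], the concavity hypothesis becomes a polynomial inequality through [G2] and
   [G3]. By [tn] it has the positive factor [t + z^2], and what remains is [t + w^2 < s w]. *)
assert (V' : 0 < 4 * s * (s * w * (t + z * z) - t * n)).
  replace (4 * s * (s * w * (t + z * z) - t * n)) with
    (2 * s * (t + w * z) * ((w + z) * s - n) + 2 * s * (t - w * z) * ((w - z) * s - n)) by ring.
  rewrite <- G2, <- G3.
  replace (t * D2 * ((w + z) * s - n) + t * D1 * ((w - z) * s - n)) with
   (t * (D2 * ((w + z) * s - n) + D1 * ((w - z) * s - n))) by ring.
  apply Z.mul_pos_pos; lia.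
rewrite tn in V'.
replace (4 * s * (s * w * (t + z * z) - (t + w * w) * (t + z * z))) with
  ((4 * s * (t + z * z)) * (s * w - (t + w * w))) in V' by ring.
pose proof (Z.square_nonneg w) as w2. pose proof (Z.square_nonneg z) as z2.
assert (0 < 4 * s * (t + z * z)) by (apply Z.mul_pos_pos; lia).
assert (V2 : t + w * w < s * w) by (apply Z.lt_0_mul in V'; lia).
assert (w0 : 0 < w).
  assert (p : 0 < s * w) by lia. apply Z.lt_0_mul in p. lia.
assert (Rl : reduced_system b w z t).
{ repeat split; try assumption.
  - unfold s in V2. lia.
  (* In [(t + w^2) (t + z^2) = s^2 (t - 16)] the left side is positive, which forces [t > 16]. *)
  - destruct (Z_lt_le_dec t 17) as [k|k]; [exfalso|exact k].
    assert (0 <= s * s * (16 - t)) by (apply Z.mul_nonneg_nonneg; [apply Z.square_nonneg|lia]).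
    assert (0 < (t + w * w) * (t + z * z)) by (apply Z.mul_pos_pos; lia).
    unfold P, Q in Et. lia.
  - unfold P, Q, s in Et. lia.
  - exists (P - t - m). unfold Q in Et. lia.
  (* [t] divides [16 s^2], [w^2 z^2] and [4 s w z], with quotients [m], [P - t - m] and [dl]; they
     are combined into [16 z^2 (s - w)^2], where [s - w = z + 2 b]. *)
  - exists (m * z * z + 16 * (P - t - m) - 8 * z * dl).
    replace ((m * z * z + 16 * (P - t - m) - 8 * z * dl) * t) with
      ((t * m) * z * z + 16 * ((P - t) * t - t * m) - 8 * z * (t * dl)) by ring.
    rewrite G1, <- ht. unfold Q, s in *. lia. }
destruct (reduced_system_solution _ _ _ _ Rl) as (b2 & w8 & z3 & t36).
assert (s = 15) by (unfold s; lia).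
rewrite w8, z3, t36, H0 in *.
unfold w, z in *. lia.
Qed.

End Diophantine.

Require Import Defs.
From mathcomp Require Import all_boot all_order all_algebra.
From mathcomp Require Import boolp classical_sets reals convex.
From mathcomp Require Import interval_inference ring lra zify.
Set Implicit Arguments.
Unset Strict Implicit.
Unset Printing Implicit Defensive.
Import Order.TTheory GRing.Theory Num.Theory.
Local Open Scope classical_set_scope.
Local Open Scope ring_scope.

(** * Determinants and distances *)

Section PlaneGeometry.
Variable R : realType.
Implicit Types (a b c d p q v : plane R) (r s t : R).

Lemma plane_eq a b : a.1 = b.1 -> a.2 = b.2 -> a = b.
Proof. by case: a => ? ?; case: b => ? ? /= -> ->. Qed.

Lemma det3E a b c : det3 a b c =
  ((b.1 : R) - a.1) * ((c.2 : R) - a.2) - ((b.2 : R) - a.2) * ((c.1 : R) - a.1).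
Proof. by []. Qed.

Lemma det3_cycle a b c : det3 b c a = det3 a b c.
Proof. rewrite !det3E. ring. Qed.

Lemma dist_ge0 a b : 0 <= dist a b.
Proof. exact: sqrtr_ge0. Qed.

Lemma dist_sqr a b : dist a b ^+ 2 = ((b.1 : R) - a.1) ^+ 2 + ((b.2 : R) - a.2) ^+ 2.
Proof. by rewrite sqr_sqrtr /dot /= -!expr2 ?addr_ge0 ?sqr_ge0. Qed.

Lemma dist_eq a b c d : dist a b ^+ 2 = dist c d ^+ 2 -> dist a b = dist c d.
Proof. by move/eqP; rewrite eqrXn2 ?dist_ge0 // => /eqP. Qed.

Lemma dist_gt0 a b : (0 < dist a b) = (a != b).
Proof.
rewrite lt0r dist_ge0 andbT -sqrf_eq0 dist_sqr paddr_eq0 ?sqr_ge0 // !sqrf_eq0 !subr_eq0.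
congr (~~ _); apply/andP/eqP => [[/eqP h1 /eqP h2]|->]; last by rewrite !eqxx.
exact: plane_eq.
Qed.


(** The barycentric coordinates of [p] are quotients of determinants. Multiplying the sign
    conditions by [det3 a b c] makes them independent of the orientation. *)
Lemma triangleP a b c p : det3 a b c != 0 ->
  0 <= det3 a b c * det3 b c p -> 0 <= det3 a b c * det3 c a p ->
  0 <= det3 a b c * det3 a b p -> triangle a b c p.
Proof.
set D := det3 a b c => D0 h1 h2 h3.
have D2 : 0 < D ^+ 2 by rewrite exprn_even_gt0.
exists (D * det3 b c p / D ^+ 2), (D * det3 c a p / D ^+ 2), (D * det3 a b p / D ^+ 2).
split; try by rewrite divr_ge0 // ltW.
- rewrite -!mulrDl -!mulrDr. have -> : det3 b c p + det3 c a p + det3 a b p = D.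
    by rewrite /D !det3E; ring.
  by rewrite -expr2 divff // lt0r_neq0.
- have E x y z (w : R) : D * w = det3 b c p * x + det3 c a p * y + det3 a b p * z ->
    w = D * det3 b c p / D ^+ 2 * x + D * det3 c a p / D ^+ 2 * y + D * det3 a b p / D ^+ 2 * z.
    by move=> h; apply: (mulfI D0); rewrite h; field.
  apply: plane_eq; apply: E; rewrite /D !det3E; ring.
Qed.

Lemma det3_triangle a b c p u v : triangle a b c p ->
  exists s t w : R, [/\ 0 <= s, 0 <= t, 0 <= w, s + t + w = 1 &
   det3 u v p = s * det3 u v a + t * det3 u v b + w * det3 u v c].
Proof.
move=> [s [t [w [hs ht hw e ->]]]]; exists s, t, w; split => //.
rewrite !det3E /=. have -> : w = 1 - s - t by rewrite -e; ring.
rewrite /GRing.scale /=. ring.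
Qed.

End PlaneGeometry.

(** * Feet of perpendiculars *)

Section Tangency.
Variable R : realType.
Implicit Types (a b c d p q v : plane R) (r s t : R).

Definition foot a b c p := exists2 t : R,
  p = a + t *: (b - a) & dot (c - p) (b - a) = 0.

(** If [s] is the parameter of the foot, the points with parameters [t] and [2 s - t] are
    equidistant from [c]; uniqueness of the common point gives [t = s]. *)
Lemma tangent_foot c r a b : a != b -> tangent c r a b ->
  exists2 p, foot a b c p & dist c p = r.
Proof.
move=> ab [p [[[t _ <-] hp] uniq]]; exists (a + t *: (b - a)) => //.
exists t => //.
have {}uniq t' : dist c (a + t' *: (b - a)) = r -> a + t *: (b - a) = a + t' *: (b - a).
  by move=> h; apply: uniq; split => //; exists t'.
have : dot (b - a) (b - a) != 0.
  by have := dist_gt0 a b; rewrite ab /dist sqrtr_gt0 => h; exact: lt0r_neq0.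
move: (b - a : plane R) uniq hp => e uniq hp e0.
pose s : R := dot (c - a) e / dot e e.
have : a + t *: e = a + (2 * s - t) *: e.
  apply: uniq; rewrite -hp; apply: dist_eq.
  rewrite !dist_sqr /=.
  have : dot (c - a) e = s * dot e e by rewrite /s divfK.
  rewrite /dot /= /GRing.scale /=.
  move: (e.1 : R) (e.2 : R) (a.1 : R) (a.2 : R) (c.1 : R) (c.2 : R) => e1 e2 a1 a2 c1 c2 h.
  apply/eqP; rewrite -subr_eq0; apply/eqP.
  transitivity (4 * (s - t) * (s * (e1 * e1 + e2 * e2) - ((c1 - a1) * e1 + (c2 - a2) * e2))).
    ring.
  by rewrite h subrr mulr0.
move/addrI => h.
have {h} : (s - t) * dot e e = 0.
  have h1 : (t - (2 * s - t)) *: e = 0 by rewrite scalerBl h subrr.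
  have h2 : (t - (2 * s - t)) * dot e e = 0.
    transitivity (dot ((t - (2 * s - t)) *: e) e).
      by rewrite /dot /= /GRing.scale /=; ring.
    by rewrite h1 /dot /= !mul0r addr0.
  have -> : (s - t) * dot e e = - (t - (2 * s - t)) * dot e e / 2 by field.
  by rewrite mulNr h2 oppr0 mul0r.
rewrite mulrBl /s divfK // => h.
rewrite -[RHS]h /dot /= /GRing.scale /=; ring.
Qed.

(** [e], [f] are the directions of two lines and [n], [m] equally long normals to them. The cross
    product of [e] with [n] has the largest absolute value possible; with [m] it is smaller, as [m]
    is not also orthogonal to [e]. *)
Lemma normal_same_side (e1 e2 f1 f2 n1 n2 m1 m2 k : R) :
  0 < k -> e1 * f2 - e2 * f1 != 0 -> n1 ^+ 2 + n2 ^+ 2 = k -> m1 ^+ 2 + m2 ^+ 2 = k ->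
  n1 * e1 + n2 * e2 = 0 -> m1 * f1 + m2 * f2 = 0 ->
  0 < (e1 * n2 - e2 * n1) * (e1 * n2 - e2 * n1 - (e1 * m2 - e2 * m1)).
Proof.
move=> k0 ef hn hm ne mf.
have em : e1 * m1 + e2 * m2 != 0.
  apply: contra ef => /eqP em; apply/eqP.
  have h : (e1 * f2 - e2 * f1) * k = 0.
    rewrite -hm; transitivity ((e1 * m1 + e2 * m2) * (m1 * f2 - m2 * f1) +
      (m1 * f1 + m2 * f2) * (e1 * m2 - e2 * m1)); first by ring.
    by rewrite em mf !mul0r addr0.
  by move/eqP: h; rewrite mulf_eq0 (gt_eqF k0) orbF => /eqP.
set X := e1 * n2 - e2 * n1; set Y := e1 * m2 - e2 * m1.
have hX : X ^+ 2 = (e1 ^+ 2 + e2 ^+ 2) * k.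
  have : X ^+ 2 + (n1 * e1 + n2 * e2) ^+ 2 = (e1 ^+ 2 + e2 ^+ 2) * k by rewrite -hn /X; ring.
  by rewrite ne expr0n addr0.
have hY : Y ^+ 2 + (e1 * m1 + e2 * m2) ^+ 2 = (e1 ^+ 2 + e2 ^+ 2) * k by rewrite -hm /Y; ring.
have em2 : 0 < (e1 * m1 + e2 * m2) ^+ 2 by rewrite exprn_even_gt0.
have XY : Y ^+ 2 < X ^+ 2 by rewrite hX -hY ltrDl.
have := sqr_ge0 (X - Y); rewrite -/X -/Y; nra.
Qed.

(* A circle tangent to two non-parallel lines touches the second one strictly on
   the side of the first where its centre lies. *)
Lemma foot_same_side a b c d v p q : foot a b v p -> foot c d v q ->
  dist v p = dist v q -> 0 < dist v p -> cross (b - a) (d - c) != 0 ->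
  0 < det3 a b v * det3 a b q.
Proof.
move=> [s ep op] [t _ oq] epq r0 abcd.
have r2 : 0 < dist v p ^+ 2 by rewrite exprn_gt0.
have := @normal_same_side (b.1 - a.1) (b.2 - a.2) (d.1 - c.1) (d.2 - c.2)
  (v.1 - p.1) (v.2 - p.2) (v.1 - q.1) (v.2 - q.2) (dist v p ^+ 2) r2 abcd.
have e1 : (v.1 - p.1 : R) ^+ 2 + (v.2 - p.2 : R) ^+ 2 = dist v p ^+ 2.
  by rewrite dist_sqr; ring.
have e2 : (v.1 - q.1 : R) ^+ 2 + (v.2 - q.2 : R) ^+ 2 = dist v p ^+ 2.
  by rewrite epq dist_sqr; ring.
move=> /(_ e1 e2 op oq) {e1 e2 op oq}.
rewrite !det3E ep /= /GRing.scale /=.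
congr (0 < _); ring.
Qed.

Lemma foot_dist a b v p : foot a b v p -> dist a p ^+ 2 = dist a v ^+ 2 - dist v p ^+ 2.
Proof.
move=> [t -> o]; rewrite !dist_sqr.
apply/eqP; rewrite -subr_eq0; apply/eqP; move: o; rewrite /dot /= /GRing.scale /= => o.
rewrite -[RHS](mulr0 (- (2 * t))) -o; ring.
Qed.

End Tangency.

(** * Position of the excircle *)

Section Excircle.
Variable R : realType.
Implicit Types (a b c d v : plane R) (p q r s t : R).

(** [c] lies strictly inside the triangle [a b d], so it is the reflex vertex and [a] the opposite
    one; [p] and [q] are its affine coordinates from [a]. *)
Definition reflex a b c d := exists p q, [/\ 0 < p, 0 < q, p + q < 1,
  c = a + p *: (b - a) + q *: (d - a) & det3 a b d != 0].

(* [X], [Y], [Z], [W] are the signed positions of the centre with respect to the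
   lines [ab], [bc], [cd], [da] in the frame of [reflex]; [al], [be], [ga] and
   [1 - et] locate the feet on these lines.  Each triple of hypotheses compares, at
   one foot, its side of the other three lines with that of the centre.  The first
   conclusion puts the centre inside the quadrilateral. *)
Lemma excircle_signs (p q al be ga et X Y Z W : R) :
  0 < p -> 0 < q -> p + q < 1 ->
  [/\ 0 < W * al, 0 < Y * (q * (1 - al)) & 0 < Z * (p - (1 - q) * al)] ->
  [/\ 0 < X * (be * q), 0 < W * (1 - be * (1 - p)) & 0 < Z * ((p + q - 1) * (1 - be))] ->
  [/\ 0 < X * (q + ga * (1 - q)), 0 < W * (p * (1 - ga)) & 0 < Y * (ga * (p + q - 1))] ->
  [/\ 0 < X * et, 0 < Y * (q - (1 - p) * et) & 0 < Z * (p * (1 - et))] ->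
  [/\ 0 < X, 0 < Y, 0 < Z & 0 < W] \/ [/\ 1 < al, 0 < be < 1, 0 < ga < 1 & 1 < et].
Proof.
move=> p0 q0 pq [W1 Y1 Z1] [X2 W2 Z2] [X3 W3 Y3] [X4 Y4 Z4].
have sgn (u v w : R) : 0 < u * v -> 0 < u /\ 0 < v \/ u < 0 /\ v < 0.
  case: (ltgtP u 0) => [u0|u0|->]; last by rewrite mul0r ltxx.
    by rewrite nmulr_rgt0 //; right.
  by rewrite pmulr_rgt0 //; left.
have sq (u v : R) : 0 < u -> (0 < u * v) = (0 < v) by move=> *; rewrite pmulr_rgt0.
have nq (u v : R) : u < 0 -> (0 < u * v) = (v < 0) by move=> *; rewrite nmulr_rgt0.
have pq1 : p + q - 1 < 0 by lra.
(* Negative [W] or [X] is contradictory, and [Y], [Z] must have the same sign: both positive for a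
   centre inside, both negative for the excircle. *)
case: (ltgtP W 0) => [w0|w0|w0]; last by move: W1; rewrite w0 mul0r ltxx.
  exfalso; rewrite !(nq W) // in W1 W2 W3.
  have g1 : 1 < ga by nra.
  have : Y < 0 by case: (sgn _ _ 0 Y3) => [] [] // y0 h; exfalso; nra.
  move=> y0; move: Y1; rewrite nq //; nra.
case: (ltgtP X 0) => [x0|x0|x0]; last by move: X4; rewrite x0 mul0r ltxx.
  exfalso; rewrite !(nq X) // in X2 X3 X4.
  have b0 : be < 0 by nra.
  have : Z < 0 by case: (sgn _ _ 0 Z2) => [] [] // z0 h; exfalso; nra.
  move=> z0; move: Z4; rewrite nq //; nra.
rewrite !(sq W) // in W1 W2 W3; rewrite !(sq X) // in X2 X3 X4.
case: (ltgtP Y 0) => [y0|y0|y0]; last by move: Y1; rewrite y0 mul0r ltxx.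
  rewrite !(nq Y) // in Y1 Y3 Y4.
  case: (ltgtP Z 0) => [z0|z0|z0]; last by move: Z1; rewrite z0 mul0r ltxx.
    rewrite !(nq Z) // in Z1 Z2 Z4.
    right; split; [nra|apply/andP; split; nra|apply/andP; split; nra|nra].
  by rewrite !(sq Z) // in Z1; exfalso; nra.
rewrite !(sq Y) // in Y1 Y3 Y4.
case: (ltgtP Z 0) => [z0|z0|z0]; last by move: Z1; rewrite z0 mul0r ltxx.
  by rewrite !(nq Z) // in Z4; exfalso; nra.
by left.
Qed.

Lemma reflex_excircle a b c d v r : reflex a b c d -> 0 < r ->
  tangent v r a b -> tangent v r b c -> tangent v r c d -> tangent v r d a ->
  ~ triangle a b c v -> ~ triangle a d c v ->
  dist a b + dist b c = dist c d + dist d a.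
Proof.
move=> [p [q [p0 q0 pq ec D0]]] r0 T1 T2 T3 T4 nabc nadc.
set D := det3 a b d in D0.
have D2 : 0 < D ^+ 2 by rewrite exprn_even_gt0.
have neq (x y z : plane R) : det3 x y z != 0 -> x != y.
  by apply: contra => /eqP ->; rewrite det3E; apply/eqP; ring.
have dabc : det3 a b c = q * D.
  by rewrite /D !det3E ec /= /GRing.scale /=; ring.
have dbcd : det3 b c d = (p + q - 1) * D.
  by rewrite /D !det3E ec /= /GRing.scale /=; ring.
have dcda : det3 c d a = p * D.
  by rewrite /D !det3E ec /= /GRing.scale /=; ring.
have ddab : det3 d a b = D by rewrite /D !det3E; ring.
have q1 : q != 0 by rewrite gt_eqF.
have p1 : p != 0 by rewrite gt_eqF.
have pq1 : p + q - 1 != 0 by rewrite lt_eqF //; lra.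
have ab : a != b by apply: (neq _ _ d).
have bc : b != c by apply: (neq _ _ d); rewrite dbcd mulf_neq0.
have cd : c != d by apply: (neq _ _ a); rewrite dcda mulf_neq0.
have da : d != a by apply: (neq _ _ b); rewrite ddab.
have [f1 F1 R1] := tangent_foot ab T1.
have [f2 F2 R2] := tangent_foot bc T2.
have [f3 F3 R3] := tangent_foot cd T3.
have [f4 F4 R4] := tangent_foot da T4.
have xab_bc : cross (b - a) (c - b) != 0.
  have -> : cross (b - a) (c - b) = q * D.
    by rewrite /D det3E /cross ec /= /GRing.scale /=; ring.
  exact: mulf_neq0.
have xbc_cd : cross (c - b) (d - c) != 0.
  have -> : cross (c - b) (d - c) = (p + q - 1) * D.
    by rewrite /D det3E /cross ec /= /GRing.scale /=; ring.
  exact: mulf_neq0.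
have xcd_da : cross (d - c) (a - d) != 0.
  have -> : cross (d - c) (a - d) = p * D.
    by rewrite /D det3E /cross ec /= /GRing.scale /=; ring.
  exact: mulf_neq0.
have xda_ab : cross (a - d) (b - a) != 0.
  have -> : cross (a - d) (b - a) = D.
    by rewrite /D det3E /cross /=; ring.
  by [].
have xab_cd : cross (b - a) (d - c) != 0.
  have -> : cross (b - a) (d - c) = (1 - q) * D.
    by rewrite /D det3E /cross ec /= /GRing.scale /=; ring.
  by apply: mulf_neq0 => //; rewrite gt_eqF //; lra.
have xbc_da : cross (c - b) (a - d) != 0.
  have -> : cross (c - b) (a - d) = (1 - p) * D.
    by rewrite /D det3E /cross ec /= /GRing.scale /=; ring.
  by apply: mulf_neq0 => //; rewrite gt_eqF //; lra.
have crossC (x y : plane R) : cross x y != 0 -> cross y x != 0.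
  by rewrite -oppr_eq0; congr (_ != 0); rewrite /cross; ring.
have side x y f x' y' f' : foot x y v f -> foot x' y' v f' ->
    dist v f = r -> dist v f' = r -> cross (y - x) (y' - x') != 0 ->
    0 < det3 x y v * det3 x y f'.
  move=> F F' e e' h; apply: (foot_same_side F F') => //; first by rewrite e.
  by rewrite e.
have S21 := side _ _ _ _ _ _ F2 F1 R2 R1 (crossC _ _ xab_bc).
have S31 := side _ _ _ _ _ _ F3 F1 R3 R1 (crossC _ _ xab_cd).
have S41 := side _ _ _ _ _ _ F4 F1 R4 R1 xda_ab.
have S12 := side _ _ _ _ _ _ F1 F2 R1 R2 xab_bc.
have S32 := side _ _ _ _ _ _ F3 F2 R3 R2 (crossC _ _ xbc_cd).
have S42 := side _ _ _ _ _ _ F4 F2 R4 R2 (crossC _ _ xbc_da).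
have S13 := side _ _ _ _ _ _ F1 F3 R1 R3 xab_cd.
have S23 := side _ _ _ _ _ _ F2 F3 R2 R3 xbc_cd.
have S43 := side _ _ _ _ _ _ F4 F3 R4 R3 (crossC _ _ xcd_da).
have S14 := side _ _ _ _ _ _ F1 F4 R1 R4 (crossC _ _ xda_ab).
have S24 := side _ _ _ _ _ _ F2 F4 R2 R4 xbc_da.
have S34 := side _ _ _ _ _ _ F3 F4 R3 R4 xcd_da.
have E1 := foot_dist F1; have E2 := foot_dist F2.
have E3 := foot_dist F3; have E4 := foot_dist F4.
have foot_end x y f : foot x y v f -> dist y f ^+ 2 = dist y v ^+ 2 - dist v f ^+ 2.
  move=> [t ef o]; apply: (@foot_dist _ y x); exists (1 - t).
    by rewrite ef; apply: plane_eq; rewrite /= /GRing.scale /=; ring.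
  by rewrite -[RHS]oppr0 -o /dot /=; ring.
have E1' := foot_end _ _ _ F1; have E2' := foot_end _ _ _ F2.
have E3' := foot_end _ _ _ F3; have E4' := foot_end _ _ _ F4.
rewrite {foot_end side} R1 R2 R3 R4 in E1 E2 E3 E4 E1' E2' E3' E4'.
move: F1 F2 F3 F4 => [al e1 _] [be e2 _] [ga e3 _] [de e4 _].
pose X := det3 a b v * D; pose Y := det3 b c v * D.
pose Z := det3 c d v * D; pose W := det3 d a v * D.
have sd u k w : w = k * D -> 0 < u * w -> 0 < u * D * k.
  by move=> ->; rewrite mulrA mulrAC.
have := @excircle_signs p q al be ga (1 - de) X Y Z W p0 q0 pq; rewrite /X /Y /Z /W.
case.
- by split; [apply: sd S41|apply: sd S21|apply: sd S31]; rewrite /D !det3E e1 ?ec /= /GRing.scale /=; ring.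
- by split; [apply: sd S12|apply: sd S42|apply: sd S32]; rewrite /D !det3E e2 ?ec /= /GRing.scale /=; ring.
- by split; [apply: sd S13|apply: sd S43|apply: sd S23]; rewrite /D !det3E e3 ?ec /= /GRing.scale /=; ring.
- by split; [apply: sd S14|apply: sd S24|apply: sd S34]; rewrite /D !det3E e4 ?ec /= /GRing.scale /=; ring.
- move=> [x0 y0 z0 w0]; exfalso.
  have dacd : det3 a d c = - p * D by rewrite /D !det3E ec /= /GRing.scale /=; ring.
  (* The side of the diagonal [a c] on which the centre lies decides which of the two triangles
     contains it. *)
  have [h|h] := lerP 0 (det3 c a v * D).
    apply: nabc; apply: triangleP; first by rewrite dabc mulf_neq0.
    + by rewrite dabc -mulrA (mulrC D) ltW // mulr_gt0.
    + by rewrite dabc -mulrA (mulrC D) mulr_ge0 // ltW.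
    + by rewrite dabc -mulrA (mulrC D) ltW // mulr_gt0.
  have swap (x y : plane R) : det3 x y v = - det3 y x v by rewrite !det3E; ring.
  apply: nadc; apply: triangleP; first by rewrite dacd mulf_neq0 ?oppr_eq0.
  + by rewrite dacd swap !mulNr mulrN opprK -mulrA (mulrC D) ltW // mulr_gt0.
  + by rewrite dacd -mulrA (mulrC D) mulNr oppr_ge0 pmulr_rle0 // ltW.
  + by rewrite dacd swap !mulNr mulrN opprK -mulrA (mulrC D) ltW // mulr_gt0.
move=> [al1 /andP[be0 be1] /andP[ga0 ga1] et1].
have sdl (x y : plane R) (t : R) : dist x (x + t *: (y - x)) = `|t| * dist x y.
  rewrite /dist -sqrtr_sqr -sqrtrM ?sqr_ge0 //.
  by congr Num.sqrt; rewrite /dot /= /GRing.scale /=; ring.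
have sdr (x y : plane R) (t : R) : dist y (x + t *: (y - x)) = `|1 - t| * dist x y.
  rewrite /dist -sqrtr_sqr -sqrtrM ?sqr_ge0 //.
  by congr Num.sqrt; rewrite /dot /= /GRing.scale /=; ring.
(* By Pythagoras, the two tangent lengths at each vertex agree. The positions of the feet remove the
   absolute values, and the claim becomes linear. *)
have A : dist a f1 = dist a f4 by apply: dist_eq; rewrite E1 E4'.
have B : dist b f1 = dist b f2 by apply: dist_eq; rewrite E2 E1'.
have C : dist c f2 = dist c f3 by apply: dist_eq; rewrite E3 E2'.
have D' : dist d f3 = dist d f4 by apply: dist_eq; rewrite E4 E3'.
move: A B C D'; rewrite e1 e2 e3 e4.
rewrite !sdl !sdr; clear -al1 be0 be1 ga0 ga1 et1.
rewrite [`|al|]ger0_norm ?[`|1 - al|]ler0_norm ?[`|be|]ger0_norm ?[`|1 - be|]ger0_norm; try lra.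
rewrite ?[`|ga|]ger0_norm ?[`|1 - ga|]ger0_norm ?[`|de|]ler0_norm ?[`|1 - de|]ger0_norm; try lra.
Qed.

End Excircle.

(** * Reflex vertices *)

Section Concavity.
Variable R : realType.
Implicit Types (a b c d p v : plane R) (r s t : R) (q : points4 R) (i j k : 'I_4).

Lemma ord4_add i : [/\ i + 1 + 1 = i + 2, i + 2 + 1 = i + 3 & i + 3 + 1 = i].
Proof. by case: i => [] [|[|[|[|i]]]] // h; split; apply/val_inj. Qed.

Lemma ord4_add2 i : [/\ i + 1 + 2 = i + 3, i + 2 + 2 = i & i + 3 + 2 = i + 1].
Proof. by case: i => [] [|[|[|[|i]]]] // h; split; apply/val_inj. Qed.

Lemma ord4_add3 i : [/\ i + 1 + 3 = i, i + 2 + 3 = i + 1 & i + 3 + 3 = i + 2].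
Proof. by case: i => [] [|[|[|[|i]]]] // h; split; apply/val_inj. Qed.

Lemma ord4_shift i j : [\/ j = i, j = i + 1, j = i + 2 | j = i + 3].
Proof.
case: i => [] [|[|[|[|i]]]] // hi; case: j => [] [|[|[|[|j]]]] // hj;
  by [constructor 1; apply/val_inj | constructor 2; apply/val_inj
     |constructor 3; apply/val_inj | constructor 4; apply/val_inj].
Qed.

(** Cramer's rule gives the coordinates of [c]. The sign of [p + q - 1] comes from splitting the
    doubled area along either diagonal: [det3 a b c + det3 c d a = det3 a b d + det3 b c d]. *)
Lemma reflex_of_signs a b c d : 0 < det3 a b c * det3 d a b ->
  0 < det3 c d a * det3 d a b -> det3 b c d * det3 d a b < 0 -> reflex a b c d.
Proof.
rewrite -(det3_cycle d a b) => habc hcda hbcd.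
set D := det3 a b d in habc hcda hbcd *.
have D0 : D != 0 by apply: contraTneq habc => ->; rewrite mulr0 ltxx.
have D2 : 0 < D ^+ 2 by rewrite exprn_even_gt0.
have divE (x : R) : x / D = x * D / D ^+ 2 by field.
exists (det3 c d a / D), (det3 a b c / D); split => //.
- by rewrite divE divr_gt0.
- by rewrite divE divr_gt0.
- rewrite -subr_lt0 -(pmulr_llt0 _ D2).
  suff -> : (det3 c d a / D + det3 a b c / D - 1) * D ^+ 2 = det3 b c d * D by [].
  rewrite [LHS](_ : _ = (det3 c d a + det3 a b c - D) * D); last by field.
  congr (_ * _); rewrite /D !det3E; ring.
- have E x (y z w : R) : D * x = D * y + det3 c d a * z + det3 a b c * w ->
    x = y + det3 c d a / D * z + det3 a b c / D * w.
    by move=> h; apply: (mulfI D0); rewrite h; field.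
  by apply: plane_eq; apply: E; rewrite /D !det3E /=; ring.
Qed.

(** [det3 c d] is affine along [a b] and changes sign; its zero is the common point. *)
Lemma segments_cross a b c d : det3 a b c * det3 a b d < 0 ->
  det3 c d a * det3 c d b < 0 -> (open_segment a b `&` open_segment c d) !=set0.
Proof.
have frac (x y : R) : x * y < 0 -> x - y != 0 /\ 0 < x / (x - y) < 1.
  move=> xy; have xy0 : x - y != 0.
    by rewrite subr_eq0; apply: contraTneq xy => ->; rewrite -leNgt -expr2 sqr_ge0.
  have h : 0 < (x - y) ^+ 2 by rewrite exprn_even_gt0.
  split=> //; apply/andP; split.
    have -> : x / (x - y) = (x ^+ 2 - x * y) / (x - y) ^+ 2 by field.
    by rewrite divr_gt0 //; have := sqr_ge0 x; lra.
  rewrite -subr_gt0; have -> : 1 - x / (x - y) = (y ^+ 2 - x * y) / (x - y) ^+ 2 by field.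
  by rewrite divr_gt0 //; have := sqr_ge0 y; lra.
move=> /frac[n1 h1] /frac[n2 h2].
exists (a + (det3 c d a / (det3 c d a - det3 c d b)) *: (b - a)); split; first by exists (det3 c d a / (det3 c d a - det3 c d b)).
exists (det3 a b c / (det3 a b c - det3 a b d)) => //.
have e : det3 c d a - det3 c d b = - (det3 a b c - det3 a b d) by rewrite !det3E; ring.
rewrite e invrN.
have E (x y z w : R) : (det3 a b c - det3 a b d) * z + det3 a b c * w =
    (det3 a b c - det3 a b d) * x - det3 c d a * y ->
  z + det3 a b c / (det3 a b c - det3 a b d) * w =
    x + (det3 c d a * - (det3 a b c - det3 a b d)^-1) * y.
  by move=> h; apply: (mulfI n1); rewrite mulrDr [RHS]mulrDr; apply: etrans (etrans h _); field.
by apply: plane_eq; apply: E; rewrite !det3E; ring.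
Qed.

(** Applied to the orientations of consecutive vertex triples. Two signs of each kind, adjacent or
    alternating, are excluded by hypothesis, so at most one sign differs from the others. *)
Lemma sign_patterns (x : 'I_4 -> R) : (forall i, x i != 0) ->
  (forall i, ~ (x i * x (i + 1) < 0 /\ x (i + 2) * x (i + 3) < 0)) ->
  (exists s, forall i, 0 < s * x i) \/
  (exists i, [/\ x i * x (i + 1) < 0, x i * x (i + 2) < 0 & x i * x (i + 3) < 0]).
Proof.
move=> x0 cr.
have := (cr 1); have := cr 0.
have [-> -> ->] : [/\ (1 + 1 = 2 :> 'I_4), (1 + 2 = 3 :> 'I_4) & (1 + 3 = 0 :> 'I_4)].
  by split; apply/val_inj.
rewrite !add0r => c0 c1.
have all4 (P : 'I_4 -> Prop) : P 0 -> P 1 -> P 2 -> P 3 -> forall i, P i.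
  by move=> ? ? ? ? i; case: (ord4_shift 0 i) => ->; rewrite ?add0r.
have lt0 i : x i > 0 \/ x i < 0.
  by case: (ltgtP (x i) 0) (x0 i) => // *; [right|left].
have one i y z w : i + 1 = y -> i + 2 = z -> i + 3 = w ->
    x i * x y < 0 -> x i * x z < 0 -> x i * x w < 0 ->
    exists i, [/\ x i * x (i + 1) < 0, x i * x (i + 2) < 0 & x i * x (i + 3) < 0].
  by move=> ey ez ew *; exists i; rewrite ey ez ew.
case: (lt0 0) (lt0 1) (lt0 2) (lt0 3) => h0 [] h1 [] h2 [] h3;
  try (by left; exists 1; apply: all4; rewrite mul1r);
  try (by left; exists (-1); apply: all4; rewrite mulN1r oppr_gt0);
  try (by exfalso; apply: c0; split; first [by rewrite pmulr_rlt0|by rewrite nmulr_rlt0]);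
  try (by exfalso; apply: c1; split; first [by rewrite pmulr_rlt0|by rewrite nmulr_rlt0]); right.
all: try by apply: (one 0 1 2 3); first [by rewrite pmulr_rlt0|by rewrite nmulr_rlt0|apply/val_inj].
all: try by apply: (one 1 2 3 0); first [by rewrite pmulr_rlt0|by rewrite nmulr_rlt0|apply/val_inj].
all: try by apply: (one 2 3 0 1); first [by rewrite pmulr_rlt0|by rewrite nmulr_rlt0|apply/val_inj].
all: apply: (one 3 0 1 2); first [by rewrite pmulr_rlt0|by rewrite nmulr_rlt0|by apply/val_inj].
Qed.

(** When all turns have the same sign, the region is the intersection of the four half-planes
    bounded by the sides. *)
Lemma convex_quad q s :
  (forall i, 0 < s * det3 (q i) (q (i + 1)) (q (i + 2))) -> convex_set (region q).
Proof.
move=> H.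
have V i k : 0 <= s * det3 (q i) (q (i + 1)) (q k).
  have [e1 e2 e3] := ord4_add i; have [f1 f2 f3] := ord4_add2 i.
  case: (ord4_shift i k) => ->.
  - by rewrite (_ : det3 _ _ _ = 0) ?mulr0 // det3E; ring.
  - by rewrite (_ : det3 _ _ _ = 0) ?mulr0 // det3E; ring.
  - exact/ltW/H.
  - by have := H (i + 3); rewrite e3 f3 -det3_cycle => /ltW.
have T (x i j k : 'I_4) p : triangle (q i) (q j) (q k) p -> 0 <= s * det3 (q x) (q (x + 1)) p.
  move=> /(@det3_triangle _ _ _ _ _ (q x) (q (x + 1))) [t1 [t2 [t3 [h1 h2 h3 _ ->]]]].
  move: (V x i) (V x j) (V x k).
  move: (det3 _ _ (q i)) (det3 _ _ (q j)) (det3 _ _ (q k)) => A B C hA hB hC.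
  have -> : s * (t1 * A + t2 * B + t3 * C) = t1 * (s * A) + t2 * (s * B) + t3 * (s * C) by ring.
  by rewrite !addr_ge0 // mulr_ge0.
have E p : region q p <-> forall i, 0 <= s * det3 (q i) (q (i + 1)) p.
  split=> [[i _ [] /T h x]|h]; [exact: h|exact: h|].
  have [[e1 e2 e3] [f1 f2 f3]] := (ord4_add 0, ord4_add2 0).
  have prod (x y : R) : 0 < s * x -> 0 <= s * y -> 0 <= x * y.
    move=> hx hy; have : 0 <= (s * x) * (s * y) by rewrite mulr_ge0 // ltW.
    have s0 : 0 < s ^+ 2.
      by rewrite exprn_even_gt0 //=; apply: contraTneq hx => ->; rewrite mul0r ltxx.
    by rewrite mulrACA -expr2 pmulr_rge0.
  have nz (x : R) : 0 < s * x -> x != 0.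
    by apply: contraTneq => ->; rewrite mulr0 ltxx.
  have H0 := H 0; have H2 := H (0 + 2); have H1 := H (0 + 1); have H3 := H (0 + 3).
  rewrite ?e1 ?e2 ?e3 ?f1 ?f2 ?f3 in H0 H1 H2 H3.
  have K0 := h 0; have K1 := h (0 + 1); have K2 := h (0 + 2); have K3 := h (0 + 3).
  rewrite ?e1 ?e2 ?e3 in K0 K1 K2 K3.
  exists 0.
    rewrite /inner_diagonal.
    have -> : det3 (q 0) (q (0 + 2)) (q (0 + 1)) = - det3 (q 0) (q (0 + 1)) (q (0 + 2)).
      by rewrite !det3E; ring.
    have -> : det3 (q 0) (q (0 + 2)) (q (0 + 3)) = det3 (q (0 + 2)) (q (0 + 3)) (q 0).
      by rewrite !det3E; ring.
    rewrite mulNr oppr_lt0 lt0r mulf_neq0 ?nz //=; exact/prod/ltW.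
  have [g|g] := lerP 0 (s * det3 (q (0 + 2)) (q 0) p); [left|right].
    by apply: triangleP; [exact: nz|exact: prod|exact: prod|exact: prod].
  have D0 : det3 (q 0) (q (0 + 3)) (q (0 + 2)) = - det3 (q (0 + 2)) (q (0 + 3)) (q 0).
    by rewrite !det3E; ring.
  have sw (x y : plane R) : det3 x y p = - det3 y x p by rewrite !det3E; ring.
  apply: triangleP; rewrite D0.
  - by rewrite oppr_eq0 nz.
  - by rewrite sw mulrNN prod.
  - rewrite mulNr -mulrN -sw prod // sw mulrN oppr_ge0; exact: ltW.
  - by rewrite sw mulrNN prod.
move=> x y l; rewrite !inE => /E hx /E hy; apply/E => i; clear T V E H.
have l0 : 0 <= l%:num by [].
have l1 : 0 <= 1 - l%:num by rewrite subr_ge0.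
have -> : conv l x y = l%:num *: (x : plane R) + (1 - l%:num) *: (y : plane R) by [].
have -> : det3 (q i) (q (i + 1)) (l%:num *: (x : plane R) + (1 - l%:num) *: (y : plane R)) =
   l%:num * det3 (q i) (q (i + 1)) x + (1 - l%:num) * det3 (q i) (q (i + 1)) y.
  by rewrite !det3E /= /GRing.scale /=; ring.
move: (hx i) (hy i); move: (det3 _ _ x) (det3 _ _ y) => A B hA hB.
have -> : s * (l%:num * A + (1 - l%:num) * B) =
    l%:num * (s * A) + (1 - l%:num) * (s * B) by ring.
by rewrite addr_ge0 // mulr_ge0.
Qed.

Lemma concave_reflex q : quadrilateral q -> concave q ->
  exists i, reflex (q i) (q (i + 1)) (q (i + 2)) (q (i + 3)).
Proof.
move=> [ncol ncross] conc.
have [| |[s /convex_quad]//|[i [h1 h2 h3]]] :=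
  @sign_patterns (fun i => det3 (q i) (q (i + 1)) (q (i + 2))).
- move=> i; apply/eqP; apply: ncol.
  + by case: i => [] [|[|[|[|i]]]].
  + by case: i => [] [|[|[|[|i]]]].
  + by case: i => [] [|[|[|[|i]]]].
- move=> i.
  have [[e1 e2 e3] [f1 f2 f3]] := (ord4_add i, ord4_add2 i).
  rewrite ?e1 ?e2 ?e3 ?f1 ?f2 ?f3 => -[h1 h2].
  (* These two sign changes put the ends of each of the opposite sides [i + 1] and [i + 3] on
     different sides of the other, so the sides would cross. *)
  have : open_segment (q (i + 1)) (q (i + 1 + 1)) `&`
         open_segment (q (i + 3)) (q (i + 3 + 1)) = set0.
    by apply: ncross; case: i {e1 e2 e3 f1 f2 f3 h1 h2} => [] [|[|[|[|i]]]].
  rewrite e1 e3; apply/eqP/set0P/segments_cross.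
    by rewrite (det3_cycle (q i)) mulrC.
  by rewrite (det3_cycle (q (i + 2))) mulrC.
have [e1 e2 e3] := ord4_add i; have [f1 f2 f3] := ord4_add2 i.
have [g1 g2 g3] := ord4_add3 i.
rewrite e1 f1 in h1; rewrite e2 f2 in h2; rewrite e3 f3 in h3.
(* The exceptional turn is at the middle vertex [i + 1] of its triple, and [i + 3] is opposite to
   it. *)
exists (i + 3); rewrite e3 f3 g3.
have opp (x y z : R) : x * y < 0 -> x * z < 0 -> 0 < y * z.
  move=> hy hz; have : 0 < (x * y) * (x * z) by rewrite nmulr_rgt0.
  have x2 : 0 < x ^+ 2 by rewrite exprn_even_gt0 //=; apply: contraTneq hy => ->; rewrite mul0r ltxx.
  by rewrite mulrACA -expr2 pmulr_rgt0.
apply: reflex_of_signs.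
- by rewrite (opp _ _ _ h3 h2).
- by rewrite (opp _ _ _ h1 h2).
- exact: h2.
Qed.

End Concavity.

(** * Integrality of the sides *)

Lemma excircle_diophantine_int (a b c d n D1 D2 : int) :
  0 < a -> 0 < b -> 0 < c -> 0 < d -> 0 < D1 -> 0 < D2 -> 0 < n -> b < c ->
  a + b = c + d -> D1 + D2 = 4 * (a + b) ->
  4 * (D1 * D1) = ((a + b) * (a + b) - n) * (n - (a - b) * (a - b)) ->
  4 * (D2 * D2) = ((a + b) * (a + b) - n) * (n - (d - c) * (d - c)) ->
  0 < D2 * ((a - b) * (a + b) - n) + D1 * ((d - c) * (a + b) - n) ->
  [/\ a = 13, b = 2, c = 5 & d = 10] /\ [/\ n = 125, D1 = 10 & D2 = 50].
Proof.
move=> *.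
suff : a = 13 /\ b = 2 /\ c = 5 /\ d = 10 /\ n = 125 /\ D1 = 10 /\ D2 = 50.
  by move=> [? [? [? [? [? [? ?]]]]]].
zify.
apply: excircle_diophantine; lia.
Qed.

Section Integrality.
Variable R : realType.
Implicit Types (a b c d : plane R) (x y : R).

(** With [k = 4 (x + y)], [8 k x = k^2 + 16 (x^2 - y^2)]. So [x] is rational, and a rational number
    with integer square is an integer. *)
Lemma sqrt_sum_int x y : 0 < x -> 0 < y -> x ^+ 2 \is a Num.int ->
  y ^+ 2 \is a Num.int -> 4 * (x + y) \is a Num.int -> x \is a Num.int.
Proof.
move=> x0 y0 /intrP[X eX] /intrP[Y eY] /intrP[k ek].
have k0 : k != 0.
  by rewrite -(intr_eq0 R) -ek mulf_neq0 // gt_eqF // addr_gt0.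
pose M := k ^+ 2 + 16 * (X - Y).
have eM : M%:~R = (8 * k)%:~R * x :> R.
  rewrite /M !(rmorphD, rmorphB, rmorphM, rmorphXn, rmorphN) /= -eX -eY -ek; ring.
have : (8 * k %| M)%Z.
  rewrite dvdzE -(@dvdn_pexp2r _ _ 2) // -!abszX -dvdzE; apply/dvdzP.
  exists X; have : (M ^+ 2)%:~R = (X * (8 * k) ^+ 2)%:~R :> R.
    by rewrite rmorphXn /= eM exprMn eX !(rmorphM, rmorphXn) mulrC.
  exact: intr_inj.
move=> /dvdzP[j ej]; apply/intrP; exists j.
have k8 : (8 * k)%:~R != 0 :> R by rewrite intr_eq0 mulf_neq0.
by apply: (mulfI k8); rewrite -eM ej rmorphM mulrC.
Qed.

Lemma reflex_metric a b c d : reflex a b c d -> dist a b + dist b c = dist c d + dist d a ->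
  [/\ 0 < dist a b, 0 < dist b c, 0 < dist c d & 0 < dist d a] /\
  [/\ 0 < `|det3 a b c|, 0 < `|det3 a c d|, 0 < dist a c ^+ 2 &
      `|det3 a b c + det3 a c d| = `|det3 a b c| + `|det3 a c d|] /\
  [/\ 4 * (`|det3 a b c| * `|det3 a b c|) =
      ((dist a b + dist b c) * (dist a b + dist b c) - dist a c ^+ 2) *
      (dist a c ^+ 2 - (dist a b - dist b c) * (dist a b - dist b c)),
      4 * (`|det3 a c d| * `|det3 a c d|) =
      ((dist a b + dist b c) * (dist a b + dist b c) - dist a c ^+ 2) *
      (dist a c ^+ 2 - (dist d a - dist c d) * (dist d a - dist c d)) &
      0 < `|det3 a c d| * ((dist a b - dist b c) * (dist a b + dist b c) - dist a c ^+ 2) +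
        `|det3 a b c| * ((dist d a - dist c d) * (dist a b + dist b c) - dist a c ^+ 2)].
Proof.
move=> [p [q [p0 q0 pq ec D0]]] es.
set D := det3 a b d in D0.
have dabc : det3 a b c = q * D by rewrite /D !det3E ec /= /GRing.scale /=; ring.
have dacd : det3 a c d = p * D by rewrite /D !det3E ec /= /GRing.scale /=; ring.
have nabc : `|det3 a b c| = q * `|D| by rewrite dabc normrM gtr0_norm.
have nacd : `|det3 a c d| = p * `|D| by rewrite dacd normrM gtr0_norm.
have D1 : 0 < `|D| by rewrite normr_gt0.
have neq (x y z : plane R) : det3 x y z != 0 -> 0 < dist x y.
  by rewrite dist_gt0; apply: contra => /eqP ->; rewrite det3E; apply/eqP; ring.
have q1 : q != 0 by rewrite gt_eqF.
have p1 : p != 0 by rewrite gt_eqF.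
have n0 : 0 < dist a c by apply: (@neq _ _ d); rewrite dacd mulf_neq0.
split.
  split; first exact: (@neq _ _ d).
  - apply: (@neq _ _ a); rewrite (_ : det3 _ _ _ = q * D) ?mulf_neq0 //.
    by rewrite -dabc !det3E; ring.
  - apply: (@neq _ _ a); rewrite (_ : det3 _ _ _ = p * D) ?mulf_neq0 //.
    by rewrite -dacd !det3E; ring.
  - by apply: (@neq _ _ b); rewrite (_ : det3 _ _ _ = D) // /D !det3E; ring.
split.
  split; first by rewrite nabc mulr_gt0.
  - by rewrite nacd mulr_gt0.
  - exact: exprn_gt0.
  - by rewrite nabc nacd dabc dacd -!mulrDl normrM gtr0_norm // addr_gt0.
have norm2 (x : R) : `|x| * `|x| = x ^+ 2 by rewrite -expr2 real_normK ?num_real.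
have heron (x y z : plane R) : 4 * det3 x y z ^+ 2 =
   4 * dist x y ^+ 2 * dist x z ^+ 2 - (dist x y ^+ 2 + dist x z ^+ 2 - dist y z ^+ 2) ^+ 2.
  by rewrite !dist_sqr !det3E; ring.
have dC (x y : plane R) : dist x y = dist y x by apply: dist_eq; rewrite !dist_sqr; ring.
split.
- by rewrite norm2 heron; ring.
- by rewrite norm2 heron es (dC a d); ring.
rewrite nabc nacd.
have -> : (dist a b - dist b c) * (dist a b + dist b c) = dist a b ^+ 2 - dist b c ^+ 2 by ring.
have -> : (dist d a - dist c d) * (dist a b + dist b c) = dist d a ^+ 2 - dist c d ^+ 2.
  by rewrite es; ring.
(* Up to the factor [|D|], this is [2 (p u + q v) . c - 2 (p + q) |c|^2] for the vectors [u], [v],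
   [c] from [a] to [b], [d], [c], and [p u + q v = c]; it is positive because [p + q < 1]. *)
have -> : p * `|D| * (dist a b ^+ 2 - dist b c ^+ 2 - dist a c ^+ 2) +
   q * `|D| * (dist d a ^+ 2 - dist c d ^+ 2 - dist a c ^+ 2) =
   `|D| * (2 * (1 - p - q) * dist a c ^+ 2).
  rewrite -!mulrA (mulrCA p) (mulrCA q) -mulrDr; congr (_ * _).
  by rewrite !dist_sqr ec /= /GRing.scale /=; ring.
by rewrite !mulr_gt0 ?exprn_gt0 //; lra.
Qed.

Lemma excircle_solution a b c d :
  (a.1 \is a Num.int /\ a.2 \is a Num.int) -> (b.1 \is a Num.int /\ b.2 \is a Num.int) ->
  (c.1 \is a Num.int /\ c.2 \is a Num.int) -> (d.1 \is a Num.int /\ d.2 \is a Num.int) ->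
  reflex a b c d -> dist a b + dist b c = dist c d + dist d a ->
  `|det3 a b c + det3 a c d| / 2 = dist a b + dist b c + dist c d + dist d a ->
  dist b c < dist c d ->
  [/\ dist a b = 13, dist b c = 2, dist c d = 5 & dist d a = 10] /\
  [/\ dist a c ^+ 2 = 125, `|det3 a b c| = 10 & `|det3 a c d| = 50].
Proof.
move=> [a1 a2] [b1 b2] [c1 c2] [d1 d2] rf es ear lt.
have [[ab0 bc0 cd0 da0] [[D10 D20 n0 sD] [E1 E2 V]]] := reflex_metric rf es.
have sqi (x y : plane R) : x.1 \is a Num.int -> x.2 \is a Num.int ->
    y.1 \is a Num.int -> y.2 \is a Num.int -> dist x y ^+ 2 \is a Num.int.
  by move=> *; rewrite dist_sqr rpredD // rpredX // rpredB.
have deti (x y z : plane R) : x.1 \is a Num.int -> x.2 \is a Num.int ->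
    y.1 \is a Num.int -> y.2 \is a Num.int -> z.1 \is a Num.int -> z.2 \is a Num.int ->
    `|det3 x y z| \is a Num.int.
  move=> *; have /intrP[m ->] : det3 x y z \is a Num.int.
    by rewrite det3E rpredB // rpredM // rpredB.
  by rewrite -intr_norm intr_int.
have eK : `|det3 a b c| + `|det3 a c d| = 4 * (dist a b + dist b c).
  by rewrite -sD; move: ear; lra.
have ab2 := sqi _ _ a1 a2 b1 b2; have bc2 := sqi _ _ b1 b2 c1 c2.
have cd2 := sqi _ _ c1 c2 d1 d2; have da2 := sqi _ _ d1 d2 a1 a2.
have kI : 4 * (dist a b + dist b c) \is a Num.int by rewrite -eK rpredD // deti.
have abI := sqrt_sum_int ab0 bc0 ab2 bc2 kI.
have bcI : dist b c \is a Num.int.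
  by apply: (sqrt_sum_int bc0 ab0 bc2 ab2); rewrite addrC.
have cdI : dist c d \is a Num.int.
  by apply: (sqrt_sum_int cd0 da0 cd2 da2); rewrite -es.
have daI : dist d a \is a Num.int.
  by apply: (sqrt_sum_int da0 cd0 da2 cd2); rewrite addrC -es.
have := sqi _ _ a1 a2 c1 c2; have := deti _ _ _ a1 a2 b1 b2 c1 c2.
have := deti _ _ _ a1 a2 c1 c2 d1 d2.
move: abI bcI cdI daI => /intrP[A eA] /intrP[B eB] /intrP[C eC] /intrP[D eD].
move=> /intrP[D2 e2] /intrP[D1 e1] /intrP[n en].
rewrite eA eB eC eD e1 e2 en in ab0 bc0 cd0 da0 D10 D20 n0 E1 E2 V es eK lt *.
have [] := @excircle_diophantine_int A B C D n D1 D2.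
- by rewrite -(ltr0z R).
- by rewrite -(ltr0z R).
- by rewrite -(ltr0z R).
- by rewrite -(ltr0z R).
- by rewrite -(ltr0z R).
- by rewrite -(ltr0z R).
- by rewrite -(ltr0z R).
- by rewrite -(ltr_int R).
- have : (A + B)%:~R = (C + D)%:~R :> R by rewrite !rmorphD.
  exact: intr_inj.
- have : (D1 + D2)%:~R = (4 * (A + B))%:~R :> R by rewrite rmorphM !rmorphD.
  exact: intr_inj.
- have : (4 * (D1 * D1))%:~R = (((A + B) * (A + B) - n) * (n - (A - B) * (A - B)))%:~R :> R.
    by rewrite ![in RHS](rmorphB, rmorphD, rmorphM) 2!rmorphM.
  exact: intr_inj.
- have : (4 * (D2 * D2))%:~R = (((A + B) * (A + B) - n) * (n - (D - C) * (D - C)))%:~R :> R.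
    by rewrite ![in RHS](rmorphB, rmorphD, rmorphM) 2!rmorphM.
  exact: intr_inj.
- by rewrite -(ltr0z R) !(rmorphB, rmorphD, rmorphM).
by move=> [-> -> -> ->] [-> -> ->].
Qed.

End Integrality.

(** * Congruences *)

Section Congruence.
Variable R : realType.
Implicit Types (a b c d v : plane R) (s t x y : R) (q : points4 R) (i j k : 'I_4).

Lemma reflex_sym a b c d : reflex a b c d -> reflex a d c b.
Proof.
move=> [p [r [p0 r0 pr e D]]]; exists r, p; split=> //; first by rewrite addrC.
  by rewrite e -!addrA (addrC (p *: _)).
rewrite (_ : det3 a d b = - det3 a b d) ?oppr_eq0 // !det3E; ring.
Qed.

Lemma reflex_same_side a b c d : reflex a b c d -> 0 < det3 a b c * det3 a c d.
Proof.
move=> [p [r [p0 r0 pr e D]]].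
have -> : det3 a b c * det3 a c d = p * r * det3 a b d ^+ 2.
  by rewrite !det3E e /= /GRing.scale /=; ring.
by apply: mulr_gt0; [exact: mulr_gt0|rewrite exprn_even_gt0].
Qed.

Lemma dist_sym a b : dist a b = dist b a.
Proof. by apply: dist_eq; rewrite !dist_sqr; ring. Qed.

Lemma big_ord4 (F : 'I_4 -> R) i :
  \sum_j F j = F i + F (i + 1) + F (i + 2) + F (i + 3).
Proof.
rewrite (reindex_inj (addrI i)) /= !big_ord_recl big_ord0.
have e0 : i + ord0 = i by exact: addr0.
have e1 : lift ord0 ord0 = 1 :> 'I_4 by exact: val_inj.
have e2 : lift ord0 (lift ord0 ord0) = 2 :> 'I_4 by exact: val_inj.
have e3 : lift ord0 (lift ord0 (lift ord0 ord0)) = 3 :> 'I_4 by exact: val_inj.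
by rewrite e0 e3 e2 e1 [_ + 0]addr0 [LHS]addrA [LHS]addrA.
Qed.

Lemma perimeterE q i : perimeter q =
  dist (q i) (q (i + 1)) + dist (q (i + 1)) (q (i + 2)) +
  dist (q (i + 2)) (q (i + 3)) + dist (q (i + 3)) (q i).
Proof.
by have [e1 e2 e3] := ord4_add i; rewrite /perimeter (big_ord4 _ i) /side e1 e2 e3.
Qed.

Lemma areaE q i : area q =
  `|det3 (q i) (q (i + 1)) (q (i + 2)) + det3 (q i) (q (i + 2)) (q (i + 3))| / 2.
Proof.
have [e1 e2 e3] := ord4_add i; rewrite /area (big_ord4 _ i) e1 e2 e3.
by congr (`|_| / 2); rewrite !det3E /cross; ring.
Qed.

(** The triangles on both sides of [a c] are congruent. The reflection in [a c] is recovered from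
    the distances to [a] and [c] and the change of orientation. *)
Lemma kite_of_sides q i : let a := q i in let b := q (i + 1) in
  let c := q (i + 2) in let d := q (i + 3) in
  0 < det3 a b c * det3 a c d -> dist a b = dist d a -> dist b c = dist c d -> kite q.
Proof.
move=> a b c d hs eab ecb.
have {}eab : dist a b ^+ 2 = dist d a ^+ 2 by rewrite eab.
have {}ecb : dist b c ^+ 2 = dist c d ^+ 2 by rewrite ecb.
have n0 : dist a c ^+ 2 != 0.
  rewrite sqrf_eq0 gt_eqF // dist_gt0; apply: contraTneq hs => ->.
  by rewrite (_ : _ * _ = 0) ?ltxx // !det3E; ring.
have ecr : det3 a b c = det3 a c d.
  have : det3 a b c ^+ 2 = det3 a c d ^+ 2.
    have h : 4 * det3 a b c ^+ 2 - 4 * det3 a c d ^+ 2 = 0.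
      transitivity (4 * dist a c ^+ 2 * (dist a b ^+ 2 - dist d a ^+ 2) -
        (dist a b ^+ 2 - dist d a ^+ 2 - (dist b c ^+ 2 - dist c d ^+ 2)) *
        (dist a b ^+ 2 + dist d a ^+ 2 + 2 * dist a c ^+ 2 - dist b c ^+ 2 - dist c d ^+ 2)).
        by rewrite !dist_sqr !det3E; ring.
      by rewrite eab ecb !subrr mulr0 mul0r subrr.
    lra.
  move/eqP; rewrite eqf_sqr => /orP[/eqP //|/eqP e].
  by move: hs; rewrite e mulNr oppr_gt0 -expr2 ltNge sqr_ge0.
have refl (x y : plane R) : dist a x ^+ 2 = dist a y ^+ 2 -> dist x c ^+ 2 = dist y c ^+ 2 ->
    det3 a x c = det3 a c y -> reflection a c x = y.
  move=> h1 h2 h3.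
  have e3 : dot (x - a) (c - a) = dot (y - a) (c - a).
    have e (z : plane R) : 2 * dot (z - a) (c - a) = dist a z ^+ 2 + dist a c ^+ 2 - dist z c ^+ 2.
      by rewrite !dist_sqr /dot /=; ring.
    by apply: (@mulfI _ 2) => //; rewrite !e h1 h2.
  have nE : dist a c ^+ 2 = dot (c - a) (c - a) by rewrite dist_sqr /dot /= -!expr2.
  rewrite nE in n0.
  have E (u w z t : R) : dot (c - a) (c - a) * (z - t + (u - t)) = 2 * dot (x - a) (c - a) * w ->
     t + (2 * (dot (x - a) (c - a) / dot (c - a) (c - a))) * w - (u - t) = z.
    by move=> h; apply: (mulfI n0); apply/eqP; rewrite -subr_eq0 -(subrr (2 * dot (x - a) (c - a) * w)) -{2}h; apply/eqP; field.
  have X (f w : R) : 2 * dot (x - a) (c - a) * f = dot (x - a) (c - a) * f + dot (y - a) (c - a) * f + (det3 a x c - det3 a c y) * w.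
    by rewrite e3 h3; ring.
  apply: plane_eq; apply: E.
    by rewrite (X _ ((c.2 : R) - a.2)) !det3E /dot /=; ring.
  by rewrite (X _ (- ((c.1 : R) - a.1))) !det3E /dot /=; ring.
have bd : reflection a c b = d by apply: refl; rewrite ?(dist_sym a d) ?(dist_sym d c).
have db : reflection a c d = b.
  apply: refl; rewrite ?(dist_sym a d) ?(dist_sym d c) ?eab ?ecb //.
  by move: ecr; rewrite !det3E => h; apply/eqP; rewrite -subr_eq0; move/eqP: h; rewrite -subr_eq0 => /eqP h; apply/eqP; rewrite -[RHS]h; ring.
have aa : reflection a c a = a.
  by apply: refl => //; rewrite !det3E; ring.
have cc : reflection a c c = c.
  by apply: refl => //; rewrite !det3E; ring.
(* The relabelling [j -> 2 i - j] fixes [i] and [i + 2] and exchanges the other two vertices. *)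
exists i, (i + i); right => j /=.
rewrite -/a -/c; case: (ord4_shift i j) => ->; rewrite -/a -/b -/c -/d ?aa ?bd ?cc ?db ?addrK //.
- by congr (q _); case: (i) => [] [|[|[|[|]]]] // ?; apply/val_inj.
- by congr (q _); case: (i) => [] [|[|[|[|]]]] // ?; apply/val_inj.
- by congr (q _); case: (i) => [] [|[|[|[|]]]] // ?; apply/val_inj.
Qed.

Lemma congruence_motion a b c d : reflex a b c d ->
  [/\ dist a b = 13, dist b c = 2, dist c d = 5 & dist d a = 10] ->
  [/\ dist a c ^+ 2 = 125, `|det3 a b c| = 10 & `|det3 a c d| = 50] ->
  exists2 f : plane R -> plane R, euclidean_motion f &
    [/\ f (0, 0) = a, f (12, 5) = b, f (10, 5) = c & f (6, 8) = d].
Proof.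
move=> /reflex_same_side hs [eab ebc ecd eda] [eac e1 e2].
have [s s2 [d1 d2]] : exists2 s : R, s ^+ 2 = 1 & det3 a b c = s * 10 /\ det3 a c d = s * 50.
  case: (ltrgt0P (det3 a b c)) e1 hs => [h1 e1|h1 e1|-> _]; last by rewrite mul0r ltxx.
    rewrite pmulr_rgt0 // => h2; exists 1; first by rewrite expr1n.
    by rewrite !mul1r -e1 -e2 gtr0_norm.
  rewrite nmulr_rgt0 // => h2; exists (-1); first by rewrite sqrrN expr1n.
  by rewrite !mulN1r -e1 -e2 ltr0_norm // !opprK.
have {s2} sgn : s = 1 \/ s = -1.
  by move/eqP: s2; rewrite sqrf_eq1 => /orP[] /eqP; [left|right].
have := dist_sqr a b; have := dist_sqr b c; have := dist_sqr c d.
have := dist_sqr d a; have := dist_sqr a c; rewrite eab ebc ecd eda eac {eab ebc ecd eda eac e1 e2 hs}.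
pose u1 : R := b.1 - a.1; pose u2 : R := b.2 - a.2.
pose w1 : R := c.1 - a.1; pose w2 : R := c.2 - a.2.
pose v1 : R := d.1 - a.1; pose v2 : R := d.2 - a.2.
rewrite det3E -/u1 -/u2 -/w1 -/w2 in d1; rewrite det3E -/w1 -/w2 -/v1 -/v2 in d2.
have -> : (a.1 : R) - d.1 = - v1 by rewrite opprB.
have -> : (a.2 : R) - d.2 = - v2 by rewrite opprB.
have -> : (d.1 : R) - c.1 = v1 - w1 by rewrite /v1 /w1; ring.
have -> : (d.2 : R) - c.2 = v2 - w2 by rewrite /v2 /w2; ring.
have -> : (c.1 : R) - b.1 = w1 - u1 by rewrite /u1 /w1; ring.
have -> : (c.2 : R) - b.2 = w2 - u2 by rewrite /u2 /w2; ring.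
rewrite -/u1 -/u2 -/w1 -/w2 => hw hv hvw huw hu.
have duw : u1 * w1 + u2 * w2 = 145.
  by move: hw huw hu; rewrite !expr2; lra.
have dvw : v1 * w1 + v2 * w2 = 100.
  by move: hw hvw hv; rewrite !expr2; lra.
have {}hu : u1 ^+ 2 + u2 ^+ 2 = 169 by rewrite -hu; ring.
(* A vector is determined by its scalar product and determinant with a given nonzero vector; only
   the sign [s] of the orientation stays free. *)
have W1 : 169 * w1 = 145 * u1 - s * 10 * u2 by rewrite -duw -d1 -hu; ring.
have W2 : 169 * w2 = 145 * u2 + s * 10 * u1 by rewrite -duw -d1 -hu; ring.
have V1 : 125 * v1 = 100 * w1 - s * 50 * w2 by rewrite -dvw -d2 hw; ring.
have V2 : 125 * v2 = 100 * w2 + s * 50 * w1 by rewrite -dvw -d2 hw; ring.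
have bE : (b.1 : R) = u1 + a.1 /\ (b.2 : R) = u2 + a.2 by rewrite !subrK.
have cE : (c.1 : R) = w1 + a.1 /\ (c.2 : R) = w2 + a.2 by rewrite !subrK.
have dE : (d.1 : R) = v1 + a.1 /\ (d.2 : R) = v2 + a.2 by rewrite !subrK.
move: bE cE dE => [b1 b2] [c1 c2] [e1 e2].
(* Cosine and sine of the rotation taking [(12, 5)] to [u], both of length 13. *)
pose x : R := (12 * u1 + 5 * u2) / 169; pose y : R := (12 * u2 - 5 * u1) / 169.
have xy : x ^+ 2 + y ^+ 2 = 1.
  have -> : x ^+ 2 + y ^+ 2 = (u1 ^+ 2 + u2 ^+ 2) / 169 by rewrite /x /y; field.
  by rewrite hu divff.
have rot : euclidean_motion (translation a \o rotation 0 x y).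
  apply: motion_comp; [exact: motion_translation|exact: motion_rotation].
clear -W1 W2 V1 V2 sgn rot b1 b2 c1 c2 e1 e2.
case: sgn => sg.
  exists (translation a \o rotation 0 x y) => //.
  by split; apply: plane_eq; rewrite /= ?b1 ?b2 ?c1 ?c2 ?e1 ?e2 /x /y;
    move: W1 W2 V1 V2; rewrite sg; lra.
(* For the opposite orientation, the model is reflected beforehand in its side from [(0, 0)] to
   [(12, 5)], whose ends stay fixed. *)
exists ((translation a \o rotation 0 x y) \o reflection 0 ((12, 5) : plane R)).
  apply: motion_comp => //; apply: motion_reflection.
  apply/eqP => /(congr1 fst) /= h; lra.
have rE (t1 t2 : R) : reflection 0 ((12, 5) : plane R) (t1, t2) =
    ((119 * t1 + 120 * t2) / 169, (120 * t1 - 119 * t2) / 169).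
  by apply: plane_eq; rewrite /reflection /dot /= /GRing.scale /=; field; lra.
by split; apply: plane_eq; rewrite /comp rE /= ?b1 ?b2 ?c1 ?c2 ?e1 ?e2 /x /y;
    move: W1 W2 V1 V2; rewrite sg; lra.
Qed.

End Congruence.

(** * Uniqueness *)

Section Uniqueness.
Variable R : realType.
Implicit Types (a b c d v : plane R) (s t x y : R) (q : points4 R) (i j k : 'I_4).

Definition example : points4 R := quad (0, 0) (12, 5) (10, 5) (6, 8).

Lemma excircle_sides q i : reflex (q i) (q (i + 1)) (q (i + 2)) (q (i + 3)) ->
  extangential q ->
  dist (q i) (q (i + 1)) + dist (q (i + 1)) (q (i + 2)) =
  dist (q (i + 2)) (q (i + 3)) + dist (q (i + 3)) (q i).
Proof.
move=> rf [c [r [r0 tg disj]]].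
have [e1 e2 e3] := ord4_add i.
have inr : ~ region q c.
  move=> h; have : (open_disc c r `&` region q) c.
    by split=> //; rewrite /open_disc /= (_ : dist c c = 0) // /dist subrr /dot /= !mul0r addr0 sqrtr0.
  by rewrite disj.
have inner : inner_diagonal q i.
  have := reflex_same_side rf; rewrite /inner_diagonal -oppr_lt0 -mulNr.
  by congr (_ * _ < 0); rewrite !det3E; ring.
apply: (reflex_excircle rf r0 (tg i)).
- by have := tg (i + 1); rewrite e1.
- by have := tg (i + 2); rewrite e2.
- by have := tg (i + 3); rewrite e3.
- by move=> h; apply: inr; exists i => //; left.
- by move=> h; apply: inr; exists i => //; right.
Qed.

Lemma example_unique q : LEQ q -> concave q -> extangential q -> ~ kite q ->
  exists2 f : plane R -> plane R, euclidean_motion f & same_quad (f \o example) q.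
Proof.
move=> [quadq intq ap] conc ext nk.
have [i rf] := concave_reflex quadq conc.
have es := excircle_sides rf ext.
move: ap; rewrite (areaE _ i) (perimeterE _ i) => ap.
have all4 (P : 'I_4 -> Prop) : P i -> P (i + 1) -> P (i + 2) -> P (i + 3) -> forall j, P j.
  by move=> ? ? ? ? j; case: (ord4_shift i j) => ->.
have ex (f : plane R -> plane R) :
    (f \o example) 0 = f (0, 0) /\ (f \o example) 1 = f (12, 5) /\
    (f \o example) 2 = f (10, 5) /\ (f \o example) 3 = f (6, 8) by [].
case: (ltgtP (dist (q (i + 1)) (q (i + 2))) (dist (q (i + 2)) (q (i + 3)))) => h.
- have [h1 h2] := excircle_solution (intq _) (intq _) (intq _) (intq _) rf es ap h.
  have [f mf [f0 f1 f2 f3]] := congruence_motion rf h1 h2.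
  exists f => //; exists (- i); left.
  have [E0 [E1 [E2 E3]]] := ex f.
  by apply: all4; rewrite ?addNr ?addKr ?E0 ?E1 ?E2 ?E3.
- have ds := @dist_sym R.
  have [h1 h2] : [/\ dist (q i) (q (i + 3)) = 13, dist (q (i + 3)) (q (i + 2)) = 2,
      dist (q (i + 2)) (q (i + 1)) = 5 & dist (q (i + 1)) (q i) = 10] /\
    [/\ dist (q i) (q (i + 2)) ^+ 2 = 125, `|det3 (q i) (q (i + 3)) (q (i + 2))| = 10
      & `|det3 (q i) (q (i + 2)) (q (i + 1))| = 50].
    apply: excircle_solution => //; first exact: reflex_sym.
    + by rewrite !(ds (q i)) !(ds (q (i + 2))); move: es; rewrite !(ds (q i)) !(ds (q (i + 2))); lra.
    + rewrite (_ : det3 _ _ _ + _ = - (det3 (q i) (q (i + 1)) (q (i + 2)) + det3 (q i) (q (i + 2)) (q (i + 3)))).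
        rewrite normrN ap (ds (q i) (q (i + 3))) (ds (q (i + 3)) (q (i + 2))) (ds (q (i + 2)) (q (i + 1))) (ds (q (i + 1)) (q i)); ring.
      by rewrite !det3E; ring.
    + by rewrite (ds (q (i + 3)) (q (i + 2))) (ds (q (i + 2)) (q (i + 1))).
  have [f mf [f0 f1 f2 f3]] := congruence_motion (reflex_sym rf) h1 h2.
  exists f => //; exists i; right.
  have [E0 [E1 [E2 E3]]] := ex f.
  have m : [/\ i - (i + 1) = 3, i - (i + 2) = 2 & i - (i + 3) = 1 ].
    by split; rewrite opprD addrA subrr add0r; apply/val_inj.
  have [m1 m2 m3] := m.
  by apply: all4; rewrite ?subrr ?m1 ?m2 ?m3 ?E0 ?E1 ?E2 ?E3.
- exfalso; apply: nk; apply: (@kite_of_sides _ q i) => //.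
    exact: reflex_same_side rf.
  by move: es; rewrite h; lra.
Qed.

End Uniqueness.

(** * The example *)

Section Example.
Variable R : realType.
Implicit Types (a b c d v : plane R) (s t x y : R) (q : points4 R) (i j k : 'I_4).

Local Notation q0 := (example R).

Lemma all_ord4 (P : 'I_4 -> Prop) : P 0 -> P 1 -> P 2 -> P 3 -> forall i, P i.
Proof. by move=> ? ? ? ? i; case: (ord4_shift 0 i) => ->; rewrite ?add0r. Qed.

Lemma dist_of_sqr a b x : 0 <= x -> dist a b ^+ 2 = x ^+ 2 -> dist a b = x.
Proof. by move=> x0 /eqP; rewrite eqrXn2 ?dist_ge0 // => /eqP. Qed.

Lemma example_sides : [/\ side q0 0 = 13, side q0 1 = 2, side q0 2 = 5 & side q0 3 = 10].
Proof. by split; apply: dist_of_sqr => //; rewrite dist_sqr /=; lra. Qed.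

Lemma example_quadrilateral : quadrilateral q0.
Proof.
split.
  apply: all_ord4; apply: all_ord4; apply: all_ord4 => // _ _ _;
    by rewrite /collinear det3E /= => ?; lra.
by apply: all_ord4; apply: all_ord4 => // _; apply/seteqP; split=> // v
  [[t /andP[t0 t1] <-] [s /andP[s0 s1]]] e;
  move: (congr1 fst e) (congr1 snd e); rewrite /= /GRing.scale /= => *; lra.
Qed.

Lemma example_LEQ : LEQ q0.
Proof.
split; first exact: example_quadrilateral.
  by apply: all_ord4; split; rewrite /= ?rpred0 ?rpred_nat.
have [s0 s1 s2 s3] := example_sides.
rewrite (areaE _ 0) /perimeter (big_ord4 _ 0) !add0r s0 s1 s2 s3.
rewrite (_ : det3 _ _ _ + _ = 60) ?ger0_norm; [lra|lra|].
by rewrite !det3E /=; lra.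
Qed.

(** The two half-planes are bounded by the side lines at the reflex vertex [(10, 5)]. Their union
    suffices both to refute convexity and to separate the region from the excircle. *)
Lemma example_region v : region q0 v -> v.2 <= 5 \/ 3 * v.1 + 4 * v.2 <= 50.
Proof.
move=> [i]; move: i; apply: all_ord4; rewrite /inner_diagonal !det3E /= => h; try lra.
all: by move=> [] [s [t [u [s0 t0 u0 e ->]]]] /=; rewrite /GRing.scale /=;
  [left + right; lra | left + right; lra].
Qed.

Lemma example_concave : concave q0.
Proof.
move=> cv.
have in0 : inner_diagonal q0 0 by rewrite /inner_diagonal !det3E /=; lra.
have B : region q0 (q0 1).
  exists 0 => //; left; exists 0, 1, 0; split=> //; first by lra.
  by rewrite !scale0r scale1r add0r addr0.
have D : region q0 (q0 3).
  exists 0 => //; right; exists 0, 1, 0; split=> //; first by lra.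
  by rewrite !scale0r scale1r add0r addr0.
have h0 : 0 <= 2^-1 :> R by lra.
have h1 : 2^-1 <= 1 :> R by lra.
(* The midpoint [(9, 13/2)] of the outer diagonal lies in neither half-plane of [example_region]. *)
have : region q0 (2^-1 *: q0 1 + (1 - 2^-1) *: q0 3).
  by have := cv (q0 1) (q0 3) (Itv01 h0 h1); rewrite !inE; apply.
by move/example_region; rewrite /= /GRing.scale /= => -[]; lra.
Qed.

Lemma tangent_of_foot v r a b p : a != b -> foot a b v p -> dist v p = r -> tangent v r a b.
Proof.
move=> ab [t -> o] d; exists (a + t *: (b - a)); split; first by split => //; exists t.
move=> _ [[s _ <-]] d'; congr (_ + _ *: _).
have : dist v (a + s *: (b - a)) ^+ 2 - dist v (a + t *: (b - a)) ^+ 2 =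
    (s - t) ^+ 2 * dist a b ^+ 2 + 2 * (t - s) * dot (v - (a + t *: (b - a))) (b - a).
  by rewrite !dist_sqr /dot /= /GRing.scale /=; ring.
rewrite d d' o subrr mulr0 addr0 => /esym /eqP.
by rewrite mulf_eq0 !sqrf_eq0 subr_eq0 [dist a b == 0]gt_eqF ?dist_gt0 // orbF => /eqP.
Qed.

Lemma example_extangential : extangential q0.
Proof.
(* This centre has distance [15/4] from the side lines [5 x = 12 y], [y = 5], [3 x + 4 y = 50] and
   [4 x = 3 y]. *)
exists (45 / 4, 35 / 4), (15 / 4); split; first by lra.
  pose v : plane R := (45 / 4, 35 / 4).
  have tan i t : let p := q0 i + t *: (q0 (i + 1) - q0 i) in
      dot (v - p) (q0 (i + 1) - q0 i) = 0 -> 0 < dist (q0 i) (q0 (i + 1)) ^+ 2 ->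
      dist v p ^+ 2 = (15 / 4) ^+ 2 -> tangent v (15 / 4) (q0 i) (q0 (i + 1)).
    move=> p o n /dist_of_sqr h; apply: (@tangent_of_foot _ _ _ _ p); last by apply: h; lra.
      by rewrite -dist_gt0 lt0r dist_ge0 andbT -sqrf_eq0 gt_eqF.
    by exists t.
  by apply: all_ord4; [apply: (tan _ (55 / 52))|apply: (tan _ (3 / 8))
    |apply: (tan _ (1 / 4))|apply: (tan _ (- 3 / 8))];
    rewrite ?dist_sqr /dot /= /GRing.scale /=; lra.
apply/seteqP; split=> // v [hd /example_region].
have : dist (45 / 4, 35 / 4) v ^+ 2 < (15 / 4) ^+ 2.
  by rewrite ltrXn2r // ?nnegrE ?dist_ge0.
rewrite dist_sqr /=; move: (v.1 : R) (v.2 : R) => x y h [] g.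
  by have := sqr_ge0 (x - 45 / 4); nra.
have := sqr_ge0 (4 * (x - 45 / 4) - 3 * (y - 35 / 4)).
(* Cauchy-Schwarz with the normal [(3, 4)] of length 5, and [75/4 = 5 (15/4)]. *)
have : (75 / 4) ^+ 2 <= (3 * (45 / 4 - x) + 4 * (35 / 4 - y)) ^+ 2 by rewrite ler_sqr ?nnegrE; lra.
by move: h; rewrite !expr2; lra.
Qed.

Lemma reflection_dist a b u v : a != b -> dist (reflection a b u) (reflection a b v) = dist u v.
Proof.
rewrite -dist_gt0 => ab; have n0 : dot (b - a) (b - a) != 0.
  have -> : dot (b - a) (b - a) = dist a b ^+ 2 by rewrite dist_sqr /dot /= -!expr2.
  by rewrite gt_eqF // exprn_gt0.
apply: dist_eq; rewrite !dist_sqr /reflection /= /GRing.scale /=.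
move: n0; rewrite /dot /= => n0; field; exact: n0.
Qed.

Lemma det3_reflection a b v : a != b -> det3 a b (reflection a b v) = - det3 a b v.
Proof.
rewrite -dist_gt0 => ab; have n0 : dot (b - a) (b - a) != 0.
  have -> : dot (b - a) (b - a) = dist a b ^+ 2 by rewrite dist_sqr /dot /= -!expr2.
  by rewrite gt_eqF // exprn_gt0.
rewrite !det3E /reflection /= /GRing.scale /=.
move: n0; rewrite /dot /= => n0; field; exact: n0.
Qed.

(** A reflection preserves side lengths and the four sides are distinct. A relabelling that keeps
    the order is therefore trivial and would make the axis pass through a third vertex; a reversing
    one would match sides of lengths 2 and 10. *)
Lemma example_not_kite : ~ kite q0.
Proof.
have [ncol _] := example_quadrilateral.
have [s0 s1 s2 s3] := example_sides.
move=> [i [k h]].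
have nc : ~ collinear (q0 i) (q0 (i + 2)) (q0 (i + 1)).
  by apply: ncol; case: (i) => [] [|[|[|[|]]]].
have ac : q0 i != q0 (i + 2).
  by apply/eqP => e; apply: nc; rewrite e /collinear det3E; ring.
have rd := fun u v => reflection_dist u v ac.
case: h => h.
  have s j : side q0 (k + j) = side q0 j by rewrite /side -addrA -!h /= rd.
  have k0 : k = 0.
    have := s 0; rewrite addr0 s0; case: (ord4_shift 0 k) => ->; rewrite ?add0r ?s1 ?s2 ?s3 // => ?; exfalso; lra.
  have := h (i + 1); rewrite k0 add0r /= => e.
  by have := det3_reflection (q0 (i + 1)) ac; rewrite e => ?; apply: nc; rewrite /collinear; lra.
(* Reversal sends side [j] to the side joining [k - j] and [k - j - 1], which is indexed by its
   lower end. *)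
have s j : side q0 (k - j - 1) = side q0 j.
  rewrite /side subrK dist_sym -addrA -opprD -!h /= rd //.
have k1 : k = 1.
  have := s 0; rewrite subr0 s0.
  have [m1 m2 m3] : [/\ 1 - 1 = 0 :> 'I_4, 2 - 1 = 1 :> 'I_4 & 3 - 1 = 2 :> 'I_4] by split; apply/val_inj.
  have m0 : 0 - 1 = 3 :> 'I_4 by apply/val_inj.
  case: (ord4_shift 0 k) => ->; rewrite ?[0 + _]add0r ?m0 ?m1 ?m2 ?m3 ?s1 ?s2 ?s3 // => ?; exfalso; lra.
have := s 1; rewrite k1 subrr (_ : 0 - 1 = 3) ?s1 ?s3; [lra|exact/val_inj].
Qed.

End Example.

Theorem corollary3 (R : realType) :
  let q0 : points4 R := quad (0, 0) (12, 5) (10, 5) (6, 8) in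
  [/\ LEQ q0, concave q0, extangential q0 & ~ kite q0] /\
  [/\ side q0 0 = 13, side q0 1 = 2, side q0 2 = 5 & side q0 3 = 10] /\
  (forall q : points4 R,
     LEQ q -> concave q -> extangential q -> ~ kite q ->
     exists2 f : plane R -> plane R,
       euclidean_motion f & same_quad (f \o q0) q).
Proof.
split; [split|split].
- exact: example_LEQ.
- exact: example_concave.
- exact: example_extangential.
- exact: example_not_kite.
- exact: example_sides.
- exact: example_unique.
Qed.
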